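(* Let $p,q,r,s$ be distinct primes such that $p \equiv q \equiv 3 \pmod 4$ and $r \equiv s \equiv 3 \pmod 4$. Then the bi-quadratic field $\mathbb{Q}(\sqrt{2p}, \sqrt{2qrs})$ is a Pólya field if $$\left(\frac{2}{r}\right) = \left(\frac{2}{s}\right) \neq \left(\frac{2}{q}\right), \qquad \left(\frac{q}{r}\right) = \left(\frac{r}{s}\right) = \left(\frac{s}{q}\right), \qquad \left(\frac{pr}{s}\right) = \left(\frac{ps}{r}\right) = -1.$$
   Context: Here $\left(\frac{a}{\ell}\right)$ is the Legendre symbol for an odd prime $\ell$. For a number field $K$ with ring of integers $\mathcal{O}_K$, a prime number $\ell$ and an integer $f\ge 1$, the Ostrowski ideal $\Pi_{\ell^f}(K)$ is the product of all maximal ideals $\mathfrak{m}$ of $\mathcal{O}_K$ with norm $N_{K/\mathbb{Q}}(\mathfrak{m}) = \ell^f$ (equal to $\mathcal{O}_K$ if there are none). The Pólya group $Po(K)$ is the subgroup of the ideal class group of $K$ generated by the classes of all Ostrowski ideals of $K$. $K$ is a Pólya field if all its Ostrowski ideals are principal, equivalently if $Po(K)$ is trivial. *)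

(* Defs.v *)
From HB Require Import structures.
From mathcomp Require Export all_boot all_order all_algebra all_field.
From mathcomp Require Export boolp classical_sets functions cardinality fsbigop.
Set Implicit Arguments.
Unset Strict Implicit.
Unset Printing Implicit Defensive.
Import GRing.Theory.
Local Open Scope classical_set_scope.
Local Open Scope ring_scope.

(* [idealr] of ring_quotient is not used because it only describes proper
   ideals: the unit ideal is needed as the value of an empty product. *)
Record ideal (R : comNzRingType) := Ideal {
  ideal_set :> R -> Prop;
  ideal0 : ideal_set 0;
  idealD : forall x y, ideal_set x -> ideal_set y -> ideal_set (x + y);
  idealM : forall a x, ideal_set x -> ideal_set (a * x) }.

HB.instance Definition _ (R : comNzRingType) := gen_eqMixin (ideal R).
HB.instance Definition _ (R : comNzRingType) := gen_choiceMixin (ideal R).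

Lemma ideal_inj (R : comNzRingType) (I J : ideal R) :
  ideal_set I = ideal_set J -> I = J.
Proof.
case: I J => [I I0 ID IM] [J J0 JD JM] /= eqIJ.
by case: J / eqIJ J0 JD JM => J0 JD JM; congr Ideal; apply: Prop_irrelevance.
Qed.

Section IdealOperations.
Variable R : comNzRingType.
Implicit Types (I J L : ideal R) (a x y : R).

Definition unit_ideal : ideal R :=
  @Ideal R setT Logic.I (fun _ _ _ _ => Logic.I) (fun _ _ _ => Logic.I).

Definition ideal_mul_set I J : set R :=
  [set x | exists2 s : seq (R * R),
     forall u, u \in s -> I u.1 /\ J u.2 & x = \sum_(u <- s) u.1 * u.2].

Fact ideal_mul0 I J : ideal_mul_set I J 0.
Proof. by exists [::]; rewrite ?big_nil. Qed.

Fact ideal_mulD I J x y :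
  ideal_mul_set I J x -> ideal_mul_set I J y -> ideal_mul_set I J (x + y).
Proof.
move=> [s sIJ ->] [t tIJ ->]; exists (s ++ t); last by rewrite big_cat.
by move=> u; rewrite mem_cat => /orP[/sIJ|/tIJ].
Qed.

Fact ideal_mulM I J a x : ideal_mul_set I J x -> ideal_mul_set I J (a * x).
Proof.
move=> [s sIJ ->]; exists [seq (a * u.1, u.2) | u <- s].
  by move=> _ /mapP[u /sIJ[Iu Ju] ->]; split=> //=; apply: idealM.
by rewrite big_map mulr_sumr; apply: eq_bigr => u _; rewrite mulrA.
Qed.

Definition ideal_mul I J : ideal R :=
  Ideal (@ideal_mul0 I J) (@ideal_mulD I J) (@ideal_mulM I J).

Lemma mem_ideal_mul I J x y : I x -> J y -> ideal_mul I J (x * y).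
Proof.
move=> Ix Jy; exists [:: (x, y)]; last by rewrite big_seq1.
by move=> u; rewrite inE => /eqP->.
Qed.

Lemma sub_ideal_mul I J L :
  (forall x y, I x -> J y -> L (x * y)) -> ideal_set (ideal_mul I J) `<=` ideal_set L.
Proof.
move=> sIJL _ [s sIJ ->]; elim: s sIJ => [|u s IHs] sIJ.
  by rewrite big_nil; apply: ideal0.
rewrite big_cons; apply: idealD.
  by have [] := sIJ u (mem_head u s); apply: sIJL.
by apply: IHs => v sv; apply: sIJ; rewrite inE sv orbT.
Qed.

Lemma ideal_mulC : commutative ideal_mul.
Proof.
by move=> I J; apply/ideal_inj/seteqP; split;
  apply: sub_ideal_mul => x y Ix Jy; rewrite mulrC; apply: mem_ideal_mul.
Qed.

Lemma ideal_mulA : associative ideal_mul.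
Proof.
have half I J L : ideal_set (ideal_mul I (ideal_mul J L))
    `<=` ideal_set (ideal_mul (ideal_mul I J) L).
  apply: sub_ideal_mul => x _ Ix [s sJL ->]; rewrite mulr_sumr.
  elim: s sJL => [|u s IHs] sJL; first by rewrite big_nil; apply: ideal0.
  rewrite big_cons; apply: idealD; last first.
    by apply: IHs => v sv; apply: sJL; rewrite inE sv orbT.
  have [Ju Lu] := sJL u (mem_head u s).
  by rewrite mulrA; apply: mem_ideal_mul => //; apply: mem_ideal_mul.
move=> I J L; apply/ideal_inj/seteqP; split; first exact: half.
rewrite (ideal_mulC _ L) (ideal_mulC I J) (ideal_mulC I _) (ideal_mulC J L).
exact: half.
Qed.

Lemma ideal_mul1 : left_id unit_ideal ideal_mul.
Proof.
move=> I; apply/ideal_inj/seteqP; split.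
  by apply: sub_ideal_mul => x y _; apply: idealM.
by move=> x Ix; rewrite -[x]mul1r; apply: mem_ideal_mul.
Qed.

HB.instance Definition _ := Monoid.isComLaw.Build (ideal R) unit_ideal ideal_mul
  ideal_mulA ideal_mulC ideal_mul1.

Definition maximal_ideal I : Prop :=
  I <> unit_ideal /\
  forall J, ideal_set I `<=` J -> J = I \/ J = unit_ideal.

Definition principal_ideal I : Prop :=
  exists a, ideal_set I = [set a * x | x in setT].

Definition ideal_cosets I : set (set R) := [set [set x + a | a in ideal_set I] | x in setT].

(* The absolute norm of I is the cardinal of R / I. *)
Definition has_ideal_norm I (n : nat) : Prop := (ideal_cosets I #= `I_n)%card.

End IdealOperations.

Section RingOfIntegers.
Variable K : fieldExtType rat.

Definition alg_integer : {pred K} := fun x => `[< integralOver (intr : int -> K) x >].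

Fact alg_integer_subring_closed : subring_closed alg_integer.
Proof.
split=> [|x y /asboolP Zx /asboolP Zy|x y /asboolP Zx /asboolP Zy]; apply/asboolP.
- exact: integral1.
- exact: integral_sub.
- exact: integral_mul.
Qed.

HB.instance Definition _ :=
  GRing.isSubringClosed.Build K alg_integer alg_integer_subring_closed.

Record ring_of_integers :=
  RingOfIntegers { integer_val :> K; _ : integer_val \in alg_integer }.

HB.instance Definition _ := [isSub for integer_val].
HB.instance Definition _ := [Choice of ring_of_integers by <:].
HB.instance Definition _ :=
  [SubChoice_isSubComNzRing of ring_of_integers by <:].

(* For l prime and f > 0 the index set is finite (these ideals are among the
   finitely many primes above l); [\big_(_ \in _)] on an infinite index set
   would be the unit ideal. *)
Definition ostrowski_ideal (l f : nat) : ideal ring_of_integers :=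
  \big[@ideal_mul _/@unit_ideal _]_(m \in
    [set m : ideal ring_of_integers | maximal_ideal m /\ has_ideal_norm m (l ^ f)])
    m.

Definition polya_field : Prop :=
  forall l f : nat, prime l -> (0 < f)%N -> principal_ideal (ostrowski_ideal l f).

End RingOfIntegers.

Definition legendre (a : int) (l : nat) : int :=
  if a%:~R == 0 :> 'F_l then 0
  else if [exists x : 'F_l, x ^+ 2 == a%:~R] then 1 else -1.

(* Main.v *)
From HB Require Import structures.
Require Import Defs.
From mathcomp Require Import zify ring lra.
Set Implicit Arguments.
Unset Strict Implicit.
Unset Printing Implicit Defensive.
Import Order.TTheory GRing.Theory Num.Theory.
Local Open Scope ring_scope.

(** Write [K = Q(sqrt (2p), sqrt (2qrs))]. Its third quadratic subfield is
    [Q(sqrt (pqrs))], where 2 is unramified since [pqrs] is 1 modulo 4; so the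
    ramified primes are 2, p, q, r and s, each with ramification index 2.

    Ideal side. The maximal ideals over a prime [l] are conjugate
    ([maximal_conjugate]), so they share one norm, and an Ostrowski ideal is
    either the unit ideal or the product of all maximal ideals over [l]. By
    comaximality this product is their intersection, and it is principal as
    soon as some [alpha] lying in each of them divides every element of the
    intersection ([prod_maximal_norm_principal]). An integer in all these
    ideals has traces divisible by [l], whence it is a multiple of [l] if [l]
    is unramified. If [l] is ramified, the same argument over the quadratic
    subfield in which [l] is unramified shows that its square is a multiple of
    [l]. So [alpha = l] works in the unramified case, and in the ramified case
    any [alpha] such that [alpha ^ 2 / l] is a unit does.

    Arithmetic side. Call [d] ambiguous if [alpha ^ 2 / d] is a unit for some
    [alpha] in [K]; it remains to see that 2, p, q, r and s are ambiguous
    ([ramified_primes_ambiguous]). Ambiguous numbers are closed under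
    quotients, and [2p] and [2qrs] are ambiguous as squares in [K]. For [N]
    one of [2p], [2qrs] and [pqrs], which are squares in [K], the smallest
    solution of [X ^ 2 - N * Y ^ 2 = 1] gives a factorisation
    [(X - 1) * (X + 1) = N * Y ^ 2], hence a nontrivial [d * e = N] with
    [d * a ^ 2 - e * b ^ 2 = 1] ([pell_split]); then [d * a + b * sqrt N]
    witnesses that [d] is ambiguous ([ambiguous_split]). For [N = 2p] this
    leaves 2 and [p] as values of [d]. Reading the equation modulo q, r and s,
    the Legendre symbols leave [2r], [qs], [2s] and [qr] for [N = 2qrs], and
    [pq] and [rs] for [N = pqrs]. In all cases the five primes follow. The same
    Pell argument for [N = qr] proves the case of quadratic reciprocity that is
    used ([legendre_reciprocity_3mod4]), and Pell equations are solved by the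
    periodicity of a flow on indefinite binary quadratic forms
    ([flow_periodic]). *)

(** * Solving the Pell equation *)

Section River.
Variable n : nat.
Hypothesis n_nonsquare : forall m : nat, (m * m)%N <> n.

(** A triple [(a, h, c)] stands for the form [a * u^2 + 2 h * u v - c * v^2],
    of discriminant [4 * (h^2 + a * c) = 4 * n]. With [a, c > 0] the form takes
    opposite signs on the basis vectors, which face each other across what
    Conway calls the river of the topograph. The sum of these vectors replaces
    the one on which the form has the same sign as on the sum. *)
Definition flow (f : int * int * int) : int * int * int :=
  let: (a, h, c) := f in
  if 0 < a + 2 * h - c then (a + 2 * h - c, h - c, c)
  else (a, h + a, c - a - 2 * h).

Definition on_river (f : int * int * int) : Prop :=
  let: (a, h, c) := f in [/\ 0 < a, 0 < c & h * h + a * c = n%:Z].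

Lemma flow_on_river f : on_river f -> on_river (flow f).
Proof.
case: f => [[a h] c] [a0 c0 disc] /=; case: ifPn => [s0|]; first by split; nia.
rewrite -leNgt le_eqVlt => /orP[/eqP s0|s0]; last by split; nia.
case: (@n_nonsquare (absz (a + h))); nia.
Qed.

(** The previous form is recovered from the sign of the value at the difference
    of the basis vectors: it is positive exactly when the first one was
    replaced. *)
Lemma flow_inj f g : on_river f -> on_river g -> flow f = flow g -> f = g.
Proof.
case: f g => [[a h] c] [[a' h'] c'] [a0 c0 _] [a0' c0' _] /=.
by case: ifP => s0; case: ifP => s0' [e1 e2 e3]; congr (_, _, _); lia.
Qed.

Lemma on_river_bounded f : on_river f ->
  let: (a, h, c) := f in [/\ `|a| <= n%:Z, `|h| <= n%:Z & `|c| <= n%:Z].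
Proof. by case: f => [[a h] c] [a0 c0 disc]; split; nia. Qed.

(** Only finitely many forms on the river have discriminant [4 * n], so the orbit
    meets itself, and by injectivity it does so first at its start. *)
Lemma flow_periodic f :
  on_river f -> exists2 k, (0 < k)%N & iter k flow f = f.
Proof.
move=> fR; pose F k := iter k flow f.
have FR k : on_river (F k) by elim: k => //= k /flow_on_river.
pose r : seq int := [seq k%:Z - n%:Z | k <- iota 0 (2 * n).+1].
have rP a : `|a| <= n%:Z -> a \in r.
  move=> le_an; apply/mapP; exists (absz (a + n%:Z)); last lia.
  by rewrite mem_iota; lia.
pose T : seq (int * int * int) := [seq (a, b) | a <- [seq (a, b) | a <- r, b <- r], b <- r].
have TP k : F k \in T.
  have := on_river_bounded (FR k); case: (F k) => [[a h] c] [/rP ? /rP ? /rP ?].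
  by rewrite !allpairs_f.
pose s := mkseq F (size T).+1.
have /(uniqPn f)[i [j []]] : ~~ uniq s.
  apply/negP=> /uniq_leq_size sT; suff: (size s <= size T)%N by rewrite size_mkseq; lia.
  by apply: sT => _ /mapP[k _ ->].
rewrite size_mkseq => lt_ij lt_jT; rewrite !nth_mkseq //; last lia.
elim: i j lt_ij {lt_jT} => [|i IHi] [|j] //= lt_ij.
  by move=> eF; exists j.+1.
by move=> /(flow_inj (FR i) (FR j)); apply: IHi.
Qed.

(** The flow with its basis recorded: [((x, y), (z, w))] are the coordinates of
    the basis vectors for the form [X^2 - n * Y^2]. *)
Definition descend (b : (nat * nat) * (nat * nat)) :=
  let: ((x, y), (z, w)) := b in
  if n%:Z * (y + w)%:Z ^+ 2 < (x + z)%:Z ^+ 2 then ((x + z, y + w)%N, (z, w))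
  else ((x, y), (x + z, y + w)%N).

Definition basis_form (b : (nat * nat) * (nat * nat)) : int * int * int :=
  let: ((x, y), (z, w)) := b in
  (x%:Z ^+ 2 - n%:Z * y%:Z ^+ 2, x%:Z * z%:Z - n%:Z * y%:Z * w%:Z,
   n%:Z * w%:Z ^+ 2 - z%:Z ^+ 2).

Lemma basis_form_descend b : basis_form (descend b) = flow (basis_form b).
Proof.
case: b => [[x y] [z w]] /=; rewrite !PoszD.
have <- : (n%:Z * (y%:Z + w%:Z) ^+ 2 < (x%:Z + z%:Z) ^+ 2) =
    (0 < x%:Z ^+ 2 - n%:Z * y%:Z ^+ 2 + 2 * (x%:Z * z%:Z - n%:Z * y%:Z * w%:Z) -
      (n%:Z * w%:Z ^+ 2 - z%:Z ^+ 2)).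
  by rewrite -subr_gt0; congr (_ < _); ring.
by case: ifP => _; rewrite /= !PoszD; congr (_, _, _); ring.
Qed.

(** When the flow started from [X^2 - n * Y^2] returns to this form, the first
    basis vector has value 1. It is not [(1, 0)]: the second vector would be
    [(0, 1)], whereas the sum of the coordinates grows at each step. *)
Lemma pell_exists :
  exists x y : nat, (0 < y)%N /\ (x * x = n * (y * y) + 1)%N.
Proof.
have n0 : (0 < n)%N by move: (@n_nonsquare 0%N); lia.
have [|k k0] := @flow_periodic (1, 0, n%:Z); first by split=> //; lia.
have -> : iter k flow (1, 0, n%:Z) = basis_form (iter k descend ((1, 0), (0, 1))%N).
  elim: k {k0} => [|k IHk] /=; last by rewrite basis_form_descend IHk.
  by congr (_, _, _); ring.
pose weight b := let: ((x, y), (z, w)) := b in (x + y + (z + w))%N.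
pose ok b := let: ((x, y), (z, w)) := b in (0 < x + y)%N && (0 < z + w)%N.
have : ok (iter k descend ((1, 0), (0, 1))%N) &&
    (2 + k <= weight (iter k descend ((1, 0), (0, 1))%N))%N.
  elim: k {k0} => //= k; case: (iter k _ _) => [[x y] [z w]] /=.
  by case: ifP => _ /=; lia.
case: (iter k _ _) => [[x y] [z w]] /= wt [xy xz zw].
exists x, y; split; last by nia.
rewrite lt0n; apply/eqP=> y0; subst y.
have x1 : x = 1%N by nia.
have z0 : z = 0%N by nia.
have : (n * (w * w) == n * 1)%N by nia.
by rewrite eqn_pmul2l // => /eqP; nia.
Qed.

End River.

(** * Splitting the Pell equation *)

Lemma coprime_mul_square (u v w : nat) :
  coprime u v -> (u * v = w * w)%N -> exists t, u = (t * t)%N.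
Proof.
move=> co_uv uv_ww; have [u0|u_gt0] := posnP u; first by exists 0%N.
exists (gcdn u w); set g := gcdn u w.
have g_gt0 : (0 < g)%N by rewrite gcdn_gt0 u_gt0.
have [u' uE] : exists u', u = (u' * g)%N by apply/dvdnP/dvdn_gcdl.
have [w' wE] : exists w', w = (w' * g)%N by apply/dvdnP/dvdn_gcdr.
have co_u'w' : coprime u' w'.
  rewrite /coprime -(eqn_pmul2r g_gt0) mul1n muln_gcdl.
  by rewrite -uE -wE eqxx.
have co_gv : coprime g v by apply: coprime_dvdl co_uv; exact: dvdn_gcdl.
clearbody g; subst u w.
have u'v : (u' * v = g * (w' * w'))%N.
  by apply/eqP; rewrite -(eqn_pmul2r g_gt0); nia.
suff -> : u' = g by [].
apply/eqP; rewrite eqn_dvd; apply/andP; split.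
  have : (u' %| g * (w' * w'))%N by rewrite -u'v dvdn_mulr.
  by rewrite !mulnA !Gauss_dvdl.
have : (g %| u' * v)%N by rewrite u'v dvdn_mulr.
by rewrite Gauss_dvdl.
Qed.

(** For the least solution, [X = 2k + 1] and [Y = 2w] by a look modulo 4, so
    the coprime numbers [k] and [k + 1] have product [n * w^2], and each is a
    divisor of [n] times a square. Were [d = 1], the two squares would be a
    smaller solution. *)
Lemma pell_split (n : nat) :
  (forall m : nat, (m * m)%N <> n) -> (n %% 4 = 1 \/ n %% 4 = 2)%N ->
  exists d e a b : nat,
    [/\ (d * e = n)%N, d <> 1%N & (d * (a * a) = e * (b * b) + 1)%N].
Proof.
move=> n_nsq n_mod4.
(* A solution has [X < n * Y^2 + 2], which makes the search for [Y] decidable. *)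
pose P y := (0 < y)%N && [exists x : 'I_(n * (y * y)).+2, (x * x == n * (y * y) + 1)%N].
have n0 : (0 < n)%N by lia.
have PI x y : (0 < y)%N -> (x * x = n * (y * y) + 1)%N -> P y.
  move=> y0 xy; rewrite /P y0; apply/existsP.
  have lt_x : (x < (n * (y * y)).+2)%N by nia.
  by exists (Ordinal lt_x); apply/eqP.
have [x0 [y0 [y0_gt0 xy0]]] := pell_exists n_nsq.
have [y /andP[y_gt0 /existsP[[x lt_x] /eqP /= xy]] y_min] :=
  ex_minnP (ex_intro P y0 (PI x0 y0 y0_gt0 xy0)).
have [k xk] : exists k, (x = 2 * k \/ x = 2 * k + 1)%N by exists (x %/ 2)%N; lia.
have [w yw] : exists w, (y = 2 * w \/ y = 2 * w + 1)%N by exists (y %/ 2)%N; lia.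
have [m nm] : exists m, (n = 4 * m + 1 \/ n = 4 * m + 2)%N by exists (n %/ 4)%N; lia.
have [xE yE] : (x = 2 * k + 1 /\ y = 2 * w)%N.
  clear -xy xk yw nm.
  by case: xk yw nm => xE [] yE [] nE; subst x y n; first [by split | exfalso; lia].
have kw : (k * k.+1 = n * (w * w))%N by clear -xy xE yE; subst x y; nia.
have co_k : coprime k k.+1 by exact: coprimenS.
pose e := gcdn k n; pose d := gcdn k.+1 n.
have den : (d * e = n)%N.
  apply/eqP; rewrite eqn_dvd Gauss_dvd; last first.
    apply: coprime_dvdl (dvdn_gcdl _ _) _; rewrite coprime_sym.
    exact: coprime_dvdl (dvdn_gcdl _ _) co_k.
  rewrite !dvdn_gcdr /= muln_gcdl !muln_gcdr !dvdn_gcd.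
  by rewrite (mulnC k.+1) kw !(dvdn_mulr _ (dvdnn n)) !(dvdn_mull _ (dvdnn n)).
have e_gt0 : (0 < e)%N by lia.
have d_gt0 : (0 < d)%N by lia.
have [k' kE] : exists k', k = (k' * e)%N by apply/dvdnP/dvdn_gcdl.
have [k'' k1E] : exists k'', k.+1 = (k'' * d)%N by apply/dvdnP/dvdn_gcdl.
clearbody d e.
have k'k'' : (k' * k'' = w * w)%N.
  apply/eqP; rewrite -(eqn_pmul2r n0) (mulnC (w * w)%N) -kw k1E {1}kE -den.
  by apply/eqP; ring.
have co_k' : coprime k' k''.
  apply: (@coprime_dvdl _ k); first by rewrite kE dvdn_mulr.
  by apply: (@coprime_dvdr _ k.+1) => //; rewrite k1E dvdn_mulr.
have [b bE] := coprime_mul_square co_k' k'k''.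
have [a aE] : exists a, k'' = (a * a)%N.
  apply: (@coprime_mul_square k'' k' w).
    by rewrite coprime_sym.
  by rewrite mulnC.
have dab : (d * (a * a) = e * (b * b) + 1)%N by rewrite -aE -bE; lia.
exists d, e, a, b; split=> // d1.
have : P b.
  apply: (PI a); last by nia.
  by rewrite lt0n; apply/eqP=> b0; nia.
move=> /y_min; rewrite leqNgt => /negP; apply.
have wab : w = (a * b)%N.
  apply/eqP; rewrite -(eqn_exp2r w (a * b) (ltn0Sn 1)) -!mulnn -k'k'' aE bE.
  by apply/eqP; ring.
have a_gt0 : (0 < a)%N by rewrite lt0n; apply/eqP=> a0; rewrite a0 in dab; lia.
have b_gt0 : (0 < b)%N.
  by rewrite lt0n; apply/eqP=> b0; rewrite yE wab b0 muln0 in y_gt0.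
have : (b <= a * b)%N by rewrite leq_pmull.
by rewrite yE wab; lia.
Qed.

(** * Legendre symbols modulo primes congruent to 3 modulo 4 *)

Section Legendre.
Variable l : nat.
Hypotheses (l_pr : prime l) (l_mod4 : l = 3 %[mod 4]).
Implicit Types a b : int.

Let Fp_natr_eq0 (n : nat) : (n%:R == 0 :> 'F_l) = (l %| n)%N.
Proof. by rewrite (dvdn_pcharf (pchar_Fp l_pr)). Qed.

(** The exponent is odd. So if [a ^ ((l - 1) / 2) = 1], then
    [a ^ ((l + 1) / 2) = a] exhibits a square root of [a]. *)
Lemma euler_criterion a : (legendre a l)%:~R = a%:~R ^+ l.-1./2 :> 'F_l.
Proof.
have lE : (l.-1./2 = 2 * (l %/ 4)%N + 1)%N by lia.
have fermat (x : 'F_l) : x != 0 -> (x ^+ l.-1./2) ^+ 2 = 1.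
  move=> x0; apply: (mulIf x0); rewrite mul1r -exprM -exprSr.
  have -> : (l.-1./2 * 2).+1 = l by lia.
  by rewrite -[in RHS](expf_card x) card_Fp.
rewrite /legendre; case: eqP => [->|/eqP a0]; first by rewrite expr0n lE addn1.
case: existsP => [[x /eqP x2]|nsq].
  by rewrite -x2 exprAC fermat //; apply: contraNneq a0 => x0; rewrite -x2 x0 expr0n.
have /eqP : (a%:~R ^+ l.-1./2) ^+ 2 = 1 :> 'F_l by apply: fermat.
rewrite sqrf_eq1 => /orP[/eqP a1|/eqP ->]; last by rewrite mulrN1z.
case: nsq; exists (a%:~R ^+ (l %/ 4)%N.+1); rewrite -exprM.
apply/eqP; transitivity (a%:~R * a%:~R ^+ l.-1./2 : 'F_l); last by rewrite a1 mulr1.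
by rewrite -exprS; congr (_ ^+ _); lia.
Qed.

Lemma intr_Fp_eq0 a : (a%:~R == 0 :> 'F_l) = (l %| absz a)%N.
Proof. by case: a => n /=; rewrite ?NegzE ?mulrNz ?oppr_eq0 Fp_natr_eq0. Qed.

Lemma legendre_val a : [\/ legendre a l = 0, legendre a l = 1 | legendre a l = -1].
Proof.
rewrite /legendre; case: ifP => _; first by constructor.
by case: ifP => _; [constructor 2 | constructor 3].
Qed.

(** Values of absolute value at most 1 are determined modulo [l > 2]. *)
Lemma legendre_unique a (e : int) :
  -1 <= e <= 1 -> a%:~R ^+ l.-1./2 = e%:~R :> 'F_l -> legendre a l = e.
Proof.
move=> e_small; rewrite -euler_criterion => /eqP.
rewrite -subr_eq0 -intrB intr_Fp_eq0 => l_dvd.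
apply/eqP; rewrite -subr_eq0 -absz_eq0; apply: contraTT l_dvd.
rewrite -lt0n => diff_gt0; apply/negP => /(dvdn_leq diff_gt0).
by case: (legendre_val a) => ->; lia.
Qed.

Lemma legendreM a b : legendre (a * b) l = legendre a l * legendre b l.
Proof.
apply: legendre_unique; last by rewrite !intrM exprMn !euler_criterion.
by case: (legendre_val a) (legendre_val b) => -> [] ->.
Qed.

Lemma legendreN1 : legendre (-1) l = -1.
Proof.
apply: legendre_unique => //; rewrite mulrN1z -signr_odd.
by have -> : odd l.-1./2 by lia.
Qed.

Lemma legendre1 : legendre 1 l = 1.
Proof. by apply: legendre_unique => //; rewrite expr1n. Qed.

Lemma legendre_modn a b : (l %| absz (a - b))%N -> legendre a l = legendre b l.
Proof. by rewrite -intr_Fp_eq0 intrB subr_eq0 /legendre => /eqP ->. Qed.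

Lemma legendre_coprime a :
  ~~ (l %| absz a)%N -> legendre a l = 1 \/ legendre a l = -1.
Proof. by rewrite /legendre intr_Fp_eq0 => /negPf ->; case: ifP; auto. Qed.

(** Modulo a divisor of [e] the equation makes [d] a square, and modulo a
    divisor of [d] it makes [- e] a square, where -1 is not one. *)
Lemma legendre_split_right (d e a b : nat) :
  (d * (a * a) = e * (b * b) + 1)%N -> (l %| e)%N -> legendre d l = 1.
Proof.
move=> dab l_e.
have : legendre (d%:Z * (a%:Z * a%:Z)) l = 1.
  rewrite -legendre1; apply: legendre_modn.
  have -> : absz (d%:Z * (a%:Z * a%:Z) - 1)%R = (e * (b * b))%N by lia.
  by rewrite dvdn_mulr.
by rewrite !legendreM; case: (legendre_val a) => -> //; rewrite ?mulrNN ?mulr1 // mulr0.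
Qed.

Lemma legendre_split_left (d e a b : nat) :
  (d * (a * a) = e * (b * b) + 1)%N -> (l %| d)%N -> legendre e l = -1.
Proof.
move=> dab l_e.
have : legendre (e%:Z * (b%:Z * b%:Z)) l = -1.
  rewrite -legendreN1; apply: legendre_modn.
  have -> : absz (e%:Z * (b%:Z * b%:Z) - -1)%R = (d * (a * a))%N by lia.
  by rewrite dvdn_mulr.
by rewrite !legendreM; case: (legendre_val b) => -> //; rewrite ?mulrNN ?mulr1 // mulr0.
Qed.

End Legendre.

(** * Splittings allowed by the Legendre symbols *)

Definition split_solution (n d : nat) : Prop :=
  exists e a b : nat, (d * e = n)%N /\ (d * (a * a) = e * (b * b) + 1)%N.

Lemma mul_eq1 (u v : nat) : (u * v = 1)%N -> u = 1%N /\ v = 1%N.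
Proof. by move/eqP; rewrite muln_eq1 => /andP[/eqP-> /eqP->]. Qed.

Lemma prime_factor_split (l m d e : nat) :
  prime l -> (d * e = l * m)%N ->
  (exists2 d', d = (l * d')%N & (d' * e = m)%N) \/
  (exists2 e', e = (l * e')%N & (d * e' = m)%N).
Proof.
move=> l_pr de; have l0 := prime_gt0 l_pr.
have : (l %| d * e)%N by rewrite de dvdn_mulr.
rewrite Euclid_dvdM // => /orP[]/dvdnP[t tE]; [left | right];
  exists t; rewrite 1?mulnC //; apply/eqP; rewrite -(eqn_pmul2l l0) -de tE;
  by apply/eqP; ring.
Qed.

Lemma nonsquare_of_prime (l n m : nat) :
  prime l -> (l %| n)%N -> ~~ (l * l %| n)%N -> (m * m)%N <> n.
Proof.
move=> l_pr l_n l2_n mn; move: l_n; rewrite -mn Euclid_dvdM // orbb => l_m.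
by move: l2_n; rewrite -mn dvdn_mul.
Qed.

Section NontrivialSplit.
Variable (n l : nat).
Hypotheses (l_pr : prime l) (l_mod4 : l = 3 %[mod 4]).
Hypotheses (l_n : (l %| n)%N) (l2_n : ~~ (l * l %| n)%N).
Hypothesis n_mod4 : (n %% 4 = 1 \/ n %% 4 = 2)%N.

(** The case [d = n] would make -1 a square modulo [l]. *)
Lemma nontrivial_split :
  exists d, [/\ split_solution n d, d <> 1%N & d <> n].
Proof.
have n_nsq m : (m * m)%N <> n by exact: nonsquare_of_prime l_pr l_n l2_n.
have [d [e [a [b [de d1 dab]]]]] := pell_split n_nsq n_mod4.
exists d; split=> //; first by exists e, a, b.
move=> dn; have e1 : e = 1%N by have : (d * e == d * 1)%N; [lia | rewrite eqn_pmul2l; lia].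
have := legendre_split_left l_pr l_mod4 dab.
by rewrite dn e1 l_n legendre1 // => /(_ isT).
Qed.
End NontrivialSplit.

Section Dichotomy.
Variables (l d e a b : nat).
Hypotheses (l_pr : prime l) (l_mod4 : l = 3 %[mod 4]).
Hypothesis dab : (d * (a * a) = e * (b * b) + 1)%N.

(** One step of the enumeration of the splittings [d * e = N]: [u] and [v]
    collect the primes already attributed to [d] and [e], and the prime [l] is
    attributed next, at the price of a condition on a Legendre symbol. *)
Lemma split_dichotomy (u v d1 e1 m : nat) :
  d = (u * d1)%N -> e = (v * e1)%N -> (d1 * e1 = l * m)%N ->
  (exists d', [/\ d = (u * l * d')%N, (d' * e1 = m)%N & legendre e l = -1]) \/
  (exists e', [/\ e = (v * l * e')%N, (d1 * e' = m)%N & legendre d l = 1]).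
Proof.
move=> dE eE /(prime_factor_split l_pr)[[d' d1E d'e]|[e' e1E e'd]].
  left; exists d'; split=> //; first by rewrite dE d1E mulnA.
  by apply: (legendre_split_left l_pr l_mod4 dab); rewrite dE d1E dvdn_mull ?dvdn_mulr.
right; exists e'; split=> //; first by rewrite eE e1E mulnA.
by apply: (legendre_split_right l_pr l_mod4 dab); rewrite eE e1E dvdn_mull ?dvdn_mulr.
Qed.
End Dichotomy.

Lemma prime_coprime_not_sq_dvd (l m : nat) :
  prime l -> coprime l m -> ~~ (l * l %| l * m)%N.
Proof.
move=> l_pr co; rewrite dvdn_pmul2l ?prime_gt0 //.
by rewrite -prime_coprime.
Qed.

(** The splitting of [q * r] must be [q * a^2 - r * b^2 = 1] or the converse;
    modulo [q] and [r] it decides both symbols, with opposite signs. *)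
Lemma legendre_reciprocity_3mod4 (q r : nat) :
  prime q -> prime r -> q <> r -> q = 3 %[mod 4] -> r = 3 %[mod 4] ->
  legendre q r = - legendre r q.
Proof.
move=> q_pr r_pr qr q4 r4.
have co_qr : coprime q r by rewrite prime_coprime // dvdn_prime2 //; apply/eqP.
have [|||d [[e [a [b [de dab]]]] d1 dn]] := @nontrivial_split (q * r) q q_pr q4.
- exact: dvdn_mulr.
- exact: prime_coprime_not_sq_dvd.
- by left; rewrite -modnMm q4 r4.
have [dE eE] : d = (1 * d)%N /\ e = (1 * e)%N by rewrite !mul1n.
have [[d' [{}dE d'e eq]]|[e' [{}eE e'd eq]]] := split_dichotomy q_pr q4 dab dE eE de.
  have := split_dichotomy r_pr r4 dab dE eE (etrans d'e (esym (muln1 r))).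
  case=> [[d'' [{}dE d''e er]]|[e'' [{}eE e''d er]]].
    by case: dn; rewrite dE; case: (mul_eq1 d''e) => -> _; lia.
  have [dq er'] : d = q /\ e = r by case: (mul_eq1 e''d) => d'1 e1; rewrite dE eE d'1 e1; lia.
  by move: er eq; rewrite dq er' => -> ->; rewrite opprK.
have := split_dichotomy r_pr r4 dab dE eE (etrans e'd (esym (muln1 r))).
case=> [[d'' [{}dE d''e er]]|[e'' [{}eE e''d er]]]; last first.
  by case: d1; case: (mul_eq1 e''d).
have [dr eq'] : d = r /\ e = q by case: (mul_eq1 d''e) => d1' e1'; rewrite dE eE d1' e1'; lia.
by move: er eq; rewrite dr eq' => -> ->.
Qed.

(** Only the trivial divisors are excluded here: 2 and [p] are both possible
    as [d], according to [p] modulo 8. *)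
Lemma split_2p (p : nat) : prime p -> p = 3 %[mod 4] ->
  split_solution (2 * p) 2 \/ split_solution (2 * p) p.
Proof.
move=> p_pr p4.
have co_2p : coprime p 2 by rewrite prime_coprime // gtnNdvd //; lia.
have [|||d [sol d1 dn]] := @nontrivial_split (2 * p) p p_pr p4.
- exact: dvdn_mull.
- by rewrite mulnC; exact: prime_coprime_not_sq_dvd.
- by right; lia.
have [e [a [b [de dab]]]] := sol.
have [[d' dE d'e]|[e' eE e'd]] := prime_factor_split (isT : prime 2) de.
  have [[d'' dE' d''e]|[e'' eE e''d]] := prime_factor_split p_pr (etrans d'e (esym (muln1 p))).
    by case: dn; rewrite dE dE'; case: (mul_eq1 d''e) => -> _; lia.
  by left; move: sol; have -> : d = 2%N by rewrite dE; case: (mul_eq1 e''d) => -> _.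
have [[d'' dE' d''e]|[e'' eE' e''d]] := prime_factor_split p_pr (etrans e'd (esym (muln1 p))).
  by right; move: sol; have -> : d = p by rewrite dE'; case: (mul_eq1 d''e) => -> _; rewrite muln1.
by case: d1; case: (mul_eq1 e''d).
Qed.

Section FourPrimes.
Variables p q r s : nat.
Hypotheses (p_pr : prime p) (q_pr : prime q) (r_pr : prime r) (s_pr : prime s).
Hypothesis (pqrs_uniq : uniq [:: p; q; r; s]).
Hypotheses (p_mod4 : p = 3 %[mod 4]) (q_mod4 : q = 3 %[mod 4]).
Hypotheses (r_mod4 : r = 3 %[mod 4]) (s_mod4 : s = 3 %[mod 4]).
Hypotheses (leg2_rs : legendre 2 r = legendre 2 s) (leg2_sq : legendre 2 s <> legendre 2 q).
Hypotheses (leg_qr_rs : legendre q r = legendre r s).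
Hypotheses (leg_rs_sq : legendre r s = legendre s q).
Hypotheses (leg_pr_s : legendre (p * r)%N s = -1) (leg_ps_r : legendre (p * s)%N r = -1).

(** The hypotheses and reciprocity leave two free signs, which determine every
    symbol that the splittings involve. *)
Lemma legendre_table : exists c t : int,
  [/\ c = 1 \/ c = -1, t = 1 \/ t = -1,
      [/\ legendre 2 q = - t, legendre r q = - c & legendre s q = c],
      [/\ legendre 2 r = t, legendre q r = c, legendre s r = - c & legendre p r = c] &
      [/\ legendre 2 s = t, legendre q s = - c, legendre r s = c & legendre p s = - c]].
Proof.
have neq : [/\ q <> r, r <> s & s <> q].
  by move: pqrs_uniq; rewrite /= !inE !negb_or; split; lia.
have [qr rs sq] := neq.
have sgn l a : prime l -> prime a -> l <> a -> legendre a l = 1 \/ legendre a l = -1.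
  by move=> lP aP la; apply: legendre_coprime => //=; rewrite dvdn_prime2 //; apply/eqP.
have sgn2 l : prime l -> l = 3 %[mod 4] -> legendre 2 l = 1 \/ legendre 2 l = -1.
  by move=> lP l4; apply: sgn => //; lia.
have rqE := legendre_reciprocity_3mod4 q_pr r_pr qr q_mod4 r_mod4.
have srE := legendre_reciprocity_3mod4 r_pr s_pr rs r_mod4 s_mod4.
have qsE := legendre_reciprocity_3mod4 s_pr q_pr sq s_mod4 q_mod4.
have c_sgn := sgn s r s_pr r_pr (nesym rs).
move: leg_pr_s leg_ps_r; rewrite !PoszM !legendreM // => ps pr.
exists (legendre r s), (legendre 2 s).
have u_sgn := sgn2 q q_pr q_mod4; have t_sgn := sgn2 s s_pr s_mod4.
move: leg2_rs leg2_sq leg_qr_rs leg_rs_sq rqE srE qsE ps pr c_sgn u_sgn t_sgn.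
move: (legendre 2 q) (legendre 2 r) (legendre 2 s) (legendre q r) (legendre r s)
  (legendre s q) (legendre r q) (legendre s r) (legendre q s) (legendre p r)
  (legendre p s) => q2 r2 s2 qr' rs' sq' rq' sr' qs' pr' ps'.
move=> -> nq2 -> <- rqE srE qsE ps pr cV uV tV.
have -> : rq' = - rs' by rewrite rqE opprK.
have -> : sr' = - rs' by rewrite srE opprK.
have -> : qs' = - rs' by rewrite qsE opprK.
have sr'E : sr' = - rs' by rewrite srE opprK.
have -> : q2 = - s2 by case: uV nq2 => ->; case: tV => ->.
have -> : pr' = rs' by move: pr; rewrite sr'E; case: cV => ->; lia.
by have -> : ps' = - rs' by move: ps; case: cV => ->; lia.
Qed.

(** The pair [{1, 2qrs}] is trivial, and [{2, qrs}] is excluded by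
    [(2/r) <> (2/q)]; by reciprocity, the others that are missing contradict
    the cyclic equality of [(q/r)], [(r/s)] and [(s/q)]. *)
Lemma split_2qrs :
  exists2 d, split_solution (2 * q * r * s) d &
    [\/ d = (2 * r)%N, d = (q * s)%N, d = (2 * s)%N | d = (q * r)%N].
Proof.
have table := legendre_table.
have [qr' qs' rs'] : [/\ q != r, q != s & r != s].
  by move: pqrs_uniq; rewrite /= !inE !negb_or; split; lia.
have co_q : coprime q (2 * r * s).
  by rewrite !coprimeMr !prime_coprime // !dvdn_prime2 // qr' qs' andbT; lia.
have [|||d [[e [a [b [de dab]]]] d1 dn]] := @nontrivial_split (2 * q * r * s) q q_pr q_mod4.
- by rewrite -!mulnA mulnCA dvdn_mulr.
- by rewrite -!mulnA mulnCA; apply: prime_coprime_not_sq_dvd => //; rewrite mulnA.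
- right; rewrite -mulnA -modnMm -[((2 * q) %% 4)%N]modnMm.
  by rewrite -[((r * s) %% 4)%N]modnMm q_mod4 r_mod4 s_mod4.
exists d; first by exists e, a, b.
have de' : (d * e = q * (r * (s * 2)))%N by rewrite de; ring.
have Lq := legendreM q_pr q_mod4; have Lr := legendreM r_pr r_mod4.
have Ls := legendreM s_pr s_mod4.
have L1q := legendre1 q_pr q_mod4; have L1r := legendre1 r_pr r_mod4.
have L1s := legendre1 s_pr s_mod4.
have [dE eE] : d = (1 * d)%N /\ e = (1 * e)%N by rewrite !mul1n.
(* Each of the sixteen splittings is trivial, contradicts the table of symbols,
   or is one of the listed values. The table is opened only after [subst], which
   would otherwise eliminate its two signs. *)
have [[d2 [{}dE de2 Eq]]|[e2 [{}eE de2 Eq]]] := split_dichotomy q_pr q_mod4 dab dE eE de';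
have [[d3 [{}dE de3 Er]]|[e3 [{}eE de3 Er]]] := split_dichotomy r_pr r_mod4 dab dE eE de2;
have [[d4 [{}dE de4 Es]]|[e4 [{}eE de4 Es]]] := split_dichotomy s_pr s_mod4 dab dE eE de3;
have [[d5 d4E /mul_eq1[d51 e51]]|[e5 e4E /mul_eq1[d51 e51]]] :=
  prime_factor_split (isT : prime 2) (etrans de4 (esym (muln1 2)));
clear de de' de2 de3 de4; subst; rewrite ?mul1n ?muln1 in Eq Er Es d1 dn *;
have [c [t [cV tV [q2 rq sq] [r2 qr sr _] [s2 qs rs _]]]] := table;
have P2 : Posz 2 = 2 by [];
move: Eq Er Es; rewrite ?PoszM ?Lq ?Lr ?Ls ?P2
  ?q2 ?rq ?sq ?r2 ?qr ?sr ?s2 ?qs ?rs ?L1q ?L1r ?L1s;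
first [ by case: d1 | by case: dn; ring
      | move=> Eq Er Es; exfalso; clear -cV tV Eq Er Es; by case: cV => ?; case: tV => ?; subst c t
      | by move=> _ _ _; constructor 1; rewrite mulnC
      | by move=> _ _ _; constructor 2
      | by move=> _ _ _; constructor 3; rewrite mulnC
      | by move=> _ _ _; constructor 4 ].
Qed.

(** The pair [{p, qrs}] is excluded by [(p/r) = - (p/s)], and the others that
    are missing contradict the table of symbols modulo [q], [r] and [s]. *)
Lemma split_pqrs :
  exists2 d, split_solution (p * q * r * s) d & d = (p * q)%N \/ d = (r * s)%N.
Proof.
have table := legendre_table.
have [pq' qr' qs' rs'] : [/\ p != q, q != r, q != s & r != s].
  by move: pqrs_uniq; rewrite /= !inE !negb_or; split; lia.
have co_q : coprime q (p * (r * s)).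
  by rewrite !coprimeMr !prime_coprime // !dvdn_prime2 // (eq_sym q p) pq' qr' qs'.
have [|||d [[e [a [b [de dab]]]] d1 dn]] := @nontrivial_split (p * q * r * s) q q_pr q_mod4.
- by rewrite -!mulnA mulnCA dvdn_mulr.
- by rewrite -!mulnA mulnCA; apply: prime_coprime_not_sq_dvd.
- left; rewrite -mulnA -modnMm -[((p * q) %% 4)%N]modnMm.
  by rewrite -[((r * s) %% 4)%N]modnMm p_mod4 q_mod4 r_mod4 s_mod4.
exists d; first by exists e, a, b.
have de' : (d * e = q * (r * (s * p)))%N by rewrite de; ring.
have Lq := legendreM q_pr q_mod4; have Lr := legendreM r_pr r_mod4.
have Ls := legendreM s_pr s_mod4.
have L1q := legendre1 q_pr q_mod4; have L1r := legendre1 r_pr r_mod4.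
have L1s := legendre1 s_pr s_mod4.
have [dE eE] : d = (1 * d)%N /\ e = (1 * e)%N by rewrite !mul1n.
(* Each of the sixteen splittings is trivial, contradicts the table of symbols,
   or is one of the listed values. The table is opened only after [subst], which
   would otherwise eliminate its two signs. *)
have [[d2 [{}dE de2 Eq]]|[e2 [{}eE de2 Eq]]] := split_dichotomy q_pr q_mod4 dab dE eE de';
have [[d3 [{}dE de3 Er]]|[e3 [{}eE de3 Er]]] := split_dichotomy r_pr r_mod4 dab dE eE de2;
have [[d4 [{}dE de4 Es]]|[e4 [{}eE de4 Es]]] := split_dichotomy s_pr s_mod4 dab dE eE de3;
have [[d5 d4E /mul_eq1[d51 e51]]|[e5 e4E /mul_eq1[d51 e51]]] :=
  prime_factor_split p_pr (etrans de4 (esym (muln1 p)));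
clear de de' de2 de3 de4; subst; rewrite ?mul1n ?muln1 in Eq Er Es d1 dn *;
have [c [t [cV tV [q2 rq sq] [r2 qr sr pr] [s2 qs rs ps]]]] := table;
move: Eq Er Es; rewrite ?PoszM ?Lq ?Lr ?Ls
  ?q2 ?rq ?sq ?r2 ?qr ?sr ?pr ?s2 ?qs ?rs ?ps ?L1q ?L1r ?L1s;
first [ by case: d1 | by case: dn; ring
      | move=> Eq Er Es; exfalso; clear -cV tV Eq Er Es; by case: cV => ?; case: tV => ?; subst c t
      | by move=> _ _ _; left; rewrite mulnC
      | by move=> _ _ _; right ].
Qed.
End FourPrimes.

(** * Products of maximal ideals *)

Section Ideals.
Local Open Scope classical_set_scope.
Variable R : comNzRingType.
Implicit Types (I J m : ideal R) (x y z : R).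

Lemma ideal_eqP I J : (forall x, I x <-> J x) -> I = J.
Proof. by move=> IJ; apply/ideal_inj/seteqP; split=> x /IJ. Qed.

Lemma ideal_eq_unit I : I 1 -> I = @unit_ideal R.
Proof.
by move=> I1; apply: ideal_eqP => x; split=> // _; rewrite -[x]mulr1; apply: idealM.
Qed.

Lemma idealN I x : I x -> I (- x).
Proof. by move=> Ix; rewrite -mulN1r; apply: idealM. Qed.

Lemma idealB I x y : I x -> I y -> I (x - y).
Proof. by move=> Ix Iy; apply: idealD => //; apply: idealN. Qed.

Lemma idealMr I x y : I x -> I (x * y).
Proof. by rewrite mulrC; apply: idealM. Qed.

Lemma ideal_sum (K : finType) I (F : K -> R) : (forall i, I (F i)) -> I (\sum_i F i).
Proof. by move=> IF; elim/big_ind: _ => //; [apply: ideal0 | apply: idealD]. Qed.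

Definition ideal_adjoin_set I a : set R := [set z | exists c t, I c /\ z = c + t * a].

Fact ideal_adjoin0 I a : ideal_adjoin_set I a 0.
Proof. by exists 0, 0; split; [apply: ideal0 | rewrite mul0r addr0]. Qed.

Fact ideal_adjoinD I a x y :
  ideal_adjoin_set I a x -> ideal_adjoin_set I a y -> ideal_adjoin_set I a (x + y).
Proof.
move=> [c [t [Ic ->]]] [d [u [Id ->]]]; exists (c + d), (t + u).
by split; [apply: idealD | ring].
Qed.

Fact ideal_adjoinM I a b x : ideal_adjoin_set I a x -> ideal_adjoin_set I a (b * x).
Proof.
move=> [c [t [Ic ->]]]; exists (b * c), (b * t).
by split; [apply: idealM | ring].
Qed.

Definition ideal_adjoin I a : ideal R :=
  Ideal (@ideal_adjoin0 I a) (@ideal_adjoinD I a) (@ideal_adjoinM I a).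

Lemma maximal_not1 m : maximal_ideal m -> ~ m 1.
Proof. by case=> m1 _ /ideal_eq_unit. Qed.

Lemma maximal_comax m a : maximal_ideal m -> ~ m a -> exists c t, m c /\ 1 = c + t * a.
Proof.
move=> [_ m_max] ma; have /m_max[] : ideal_set m `<=` ideal_adjoin m a.
- by move=> x mx; exists x, 0; split=> //; rewrite mul0r addr0.
- move=> adj; case: ma; rewrite -adj; exists 0, 1.
  by split; [apply: ideal0 | rewrite add0r mul1r].
by move=> adj; have : ideal_adjoin m a 1 by rewrite adj.
Qed.

Lemma maximal_prime m x y : maximal_ideal m -> m (x * y) -> m x \/ m y.
Proof.
move=> m_max mxy; have [mx|/(maximal_comax m_max)[c [t [mc e1]]]] := pselect (m x).
  by left.
right; rewrite -[y]mul1r e1 mulrDl; apply: idealD; first exact: idealMr.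
by rewrite -mulrA; apply: idealM.
Qed.

Lemma maximal_prod (K : finType) m (F : K -> R) :
  maximal_ideal m -> m (\prod_i F i) -> exists i, m (F i).
Proof.
move=> m_max; rewrite -big_enum; elim: (enum K) => [|i s IHs].
  by rewrite big_nil => /(maximal_not1 m_max).
by rewrite big_cons => /(maximal_prime m_max)[mi|/IHs //]; exists i.
Qed.

Lemma maximal_sub m m' :
  maximal_ideal m -> maximal_ideal m' -> ideal_set m `<=` m' -> m = m'.
Proof. by move=> [_ m_max] [m1 _] /m_max[->|/m1]. Qed.

Lemma maximal_neq m m' :
  maximal_ideal m -> maximal_ideal m' -> m <> m' -> exists2 x, m x & ~ m' x.
Proof.
move=> mM m'M neq; apply: contrapT => none; case: neq; apply: maximal_sub => // x mx.
by apply: contrapT => m'x; apply: none; exists x.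
Qed.

Local Notation ideal_prod s := (\big[@ideal_mul R/@unit_ideal R]_(J <- s) J).

Lemma ideal_prod_sub (s : seq (ideal R)) J : J \in s -> ideal_set (ideal_prod s) `<=` J.
Proof.
move=> Js x; rewrite (big_rem J Js) /= => -[t tJ ->]; rewrite big_seq.
elim/big_ind: _ => [|u v Ju Jv|u ut]; [exact: ideal0 | exact: idealD |].
by apply: idealMr; case: (tJ u ut).
Qed.

Lemma ideal_prod_nsub (s : seq (ideal R)) m :
  maximal_ideal m -> (forall J, J \in s -> exists2 x, J x & ~ m x) ->
  exists2 x, ideal_prod s x & ~ m x.
Proof.
move=> m_max; elim: s => [|J s IHs] sJ.
  by exists 1; [rewrite big_nil | apply: maximal_not1].
have [x Jx mx] := sJ J (mem_head _ _).
have [|y sy my] := IHs; first by move=> I Is; apply: sJ; rewrite inE Is orbT.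
exists (x * y); last by move=> /(maximal_prime m_max)[].
by rewrite big_cons; apply: mem_ideal_mul.
Qed.

(** Distinct maximal ideals are comaximal: with [1 = c + t * y], [c] in the
    first ideal and [y] in the product of the others, an [x] common to all of
    them is [c * x + t * y * x]. *)
Lemma ideal_prod_inter (s : seq (ideal R)) x :
  uniq s -> (forall J, J \in s -> maximal_ideal J /\ J x) -> ideal_prod s x.
Proof.
elim: s => [|J s IHs] /=; first by rewrite big_nil.
move=> /andP[sJ s_uniq] sx; rewrite big_cons.
have [JM Jx] := sx J (mem_head _ _).
have sx' I : I \in s -> maximal_ideal I /\ I x by move=> Is; apply: sx; rewrite inE Is orbT.
have [|y sy Jy] := @ideal_prod_nsub s J JM.
  move=> I Is; apply: maximal_neq => //; first by case: (sx' I Is).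
  by move=> IJ; rewrite -IJ Is in sJ.
have [c [t [Jc e1]]] := maximal_comax JM Jy.
rewrite -[x]mul1r e1 mulrDl; apply: idealD.
  by apply: mem_ideal_mul => //; apply: IHs.
by rewrite ideal_mulC; apply: mem_ideal_mul => //; apply: idealM.
Qed.

(** Adding 1 permutes the [n] cosets. Summing representatives before and after
    the permutation shows that [n] is in the ideal. *)
Lemma norm_mem I n : has_ideal_norm I n -> I n%:R.
Proof.
move=> /card_set_bijP[f [f_fun f_inj f_surj]].
pose coset x : set R := [set x + a | a in ideal_set I].
have cosetP x y : coset x = coset y <-> I (x - y).
  split=> [xy|Ixy].
    have [a Ia <-] : coset y x.
      by rewrite -xy; exists 0; [exact: ideal0 | rewrite addr0].
    by rewrite addrC addKr.
  apply/seteqP; split=> _ [a Ia <-].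
    by exists (x - y + a); [apply: idealD | ring].
  by exists (a - (x - y)); [apply: idealB | ring].
have cosetI x : ideal_cosets I (coset x) by exists x.
pose idx x := Ordinal (f_fun _ (cosetI x)).
have idxP x y : idx x = idx y <-> I (x - y).
  rewrite -cosetP; split=> [[]|xy].
    by apply: f_inj; rewrite inE.
  by apply: val_inj; rewrite /= xy.
have /choice[rep repK] (i : 'I_n) : exists x, idx x = i.
  have [_ [x _ <-] fx] := f_surj i (ltn_ord i).
  by exists x; apply: val_inj.
pose sh i := idx (rep i + 1).
have sh_inj : injective sh.
  move=> i j /idxP; rewrite opprD addrACA subrr addr0 => /idxP.
  by rewrite !repK.
have -> : n%:R = \sum_i (rep i + 1 - rep (sh i)) :> R.
  rewrite sumrB big_split /= sumr_const card_ord.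
  by rewrite [X in _ = _ - X](_ : _ = \sum_i rep i) ?[_ + n%:R]addrC ?addrK //
    [RHS](reindex_inj sh_inj).
by apply: ideal_sum => i; apply/idxP; rewrite repK.
Qed.

Section Preimage.
Variables (g : {rmorphism R -> R}).

Fact ideal_preim0 I : I (g 0). Proof. by rewrite rmorph0; apply: ideal0. Qed.
Fact ideal_preimD I x y : I (g x) -> I (g y) -> I (g (x + y)).
Proof. by rewrite rmorphD; apply: idealD. Qed.
Fact ideal_preimM I a x : I (g x) -> I (g (a * x)).
Proof. by rewrite rmorphM; apply: idealM. Qed.

Definition ideal_preim I : ideal R :=
  @Ideal R (fun x => I (g x)) (ideal_preim0 I) (@ideal_preimD I) (@ideal_preimM I).

Hypothesis g_bij : bijective g.

(** The image is an ideal by surjectivity; it carries maximality over to the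
    preimage. *)
Definition ideal_image_set I : set R := [set g x | x in ideal_set I].
Fact ideal_image0 I : ideal_image_set I 0.
Proof. by exists 0; [apply: ideal0 | rewrite rmorph0]. Qed.
Fact ideal_imageD I x y :
  ideal_image_set I x -> ideal_image_set I y -> ideal_image_set I (x + y).
Proof. by move=> [u Iu <-] [v Iv <-]; exists (u + v); [apply: idealD | rewrite rmorphD]. Qed.
Fact ideal_imageM I a x : ideal_image_set I x -> ideal_image_set I (a * x).
Proof.
case: g_bij => h _ hK [u Iu <-]; exists (h a * u); first exact: idealM.
by rewrite rmorphM hK.
Qed.
Definition ideal_image I : ideal R :=
  Ideal (@ideal_image0 I) (@ideal_imageD I) (@ideal_imageM I).

Lemma maximal_preim m : maximal_ideal m -> maximal_ideal (ideal_preim m).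
Proof.
have [h gK hK] := g_bij; move=> mM; split.
  move=> e; apply: (maximal_not1 mM); rewrite -(rmorph1 g).
  by have : ideal_preim m 1 by rewrite e.
move=> J mJ; have /(proj2 mM)[] : ideal_set m `<=` ideal_image J.
- by move=> x mx; exists (h x); [apply: mJ; rewrite /= hK | rewrite hK].
- move=> e; left; apply: ideal_eqP => x; split; last exact: mJ.
  by move=> Jx; rewrite /= -e; exists x.
move=> e; right; apply: ideal_eq_unit.
have [u Ju gu] : ideal_image J 1 by rewrite e.
by have <- : u = 1 by apply: (can_inj gK); rewrite gu rmorph1.
Qed.

Lemma norm_preim I n : has_ideal_norm I n -> has_ideal_norm (ideal_preim I) n.
Proof.
have [h gK hK] := g_bij; rewrite /has_ideal_norm => In.
suff -> : ideal_cosets (ideal_preim I) = [set g @^-1` C | C in ideal_cosets I].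
  apply: card_eq_trans In; apply: inj_card_eq => C D _ _ CD.
  apply/seteqP; split=> x; rewrite -[x]hK.
    by move=> Cx; have : (g @^-1` C) (h x) by []; rewrite CD.
  by move=> Dx; have : (g @^-1` D) (h x) by []; rewrite -CD.
apply/seteqP; split=> [_ [x _ <-]|_ [_ [x _ <-] <-]].
  exists [set g x + a | a in ideal_set I]; first by exists (g x).
  apply/seteqP; split=> y /=.
    move=> [a Ia e]; exists (h a); first by rewrite /= hK.
    by apply: (can_inj gK); rewrite rmorphD hK.
  by move=> [a Ia <-]; exists (g a) => //; rewrite rmorphD.
exists (h x) => //; apply/seteqP; split=> y /=.
  by move=> [a Ia <-]; exists (g a) => //; rewrite rmorphD hK.
move=> [a Ia e]; exists (h a); first by rewrite /= hK.
by apply: (can_inj gK); rewrite rmorphD !hK.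
Qed.
End Preimage.
End Ideals.

Section ConjugateIdeals.
Local Open Scope classical_set_scope.
Variables (R : comNzRingType) (G : finType) (g : G -> {rmorphism R -> R}) (i1 : G).
Hypotheses (g_bij : forall i, bijective (g i)) (g1 : g i1 =1 id).
Hypothesis norm_int : forall x, exists k : int, \prod_i g i x = k%:~R.
Variable l : nat.
Hypothesis l_pr : prime l.
Implicit Types m : ideal R.

Lemma maximal_int m (k : int) :
  maximal_ideal m -> m l%:R -> m k%:~R -> (l %| absz k)%N.
Proof.
move=> mM ml mk; apply: contrapT => /negP; rewrite -prime_coprime // => co_lk.
apply: (maximal_not1 mM).
have /coprimezP[[u v] /= uv] : coprimez l k by [].
have -> : 1 = u%:~R * l%:R + v%:~R * k%:~R :> R.
  by rewrite pmulrn -!intrM -intrD uv.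
by apply: idealD; apply: idealM.
Qed.

(** Otherwise comaximality gives an [a] in [m'] outside all conjugates of [m],
    and its norm, a multiple of [l], lies in the prime ideal [m]. *)
Lemma maximal_conjugate m m' :
  maximal_ideal m -> m l%:R -> maximal_ideal m' -> m' l%:R ->
  exists i, m' = ideal_preim (g i) m.
Proof.
move=> mM ml m'M m'l; apply: contrapT => noconj.
(* [x0] lies in the product of all conjugates of [m], but not in [m']. *)
have [x0 xm m'x0] : exists2 x, (forall i, m (g i x)) & ~ m' x.
  have [|x sx m'x] := @ideal_prod_nsub R [seq ideal_preim (g i) m | i <- enum G] m' m'M.
    move=> _ /mapP[i _ ->]; apply: maximal_neq => //; first exact: maximal_preim.
    by move=> e; apply: noconj; exists i.
  exists x => // i; have := @ideal_prod_sub R _ (ideal_preim (g i) m) _ x sx.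
  by apply; apply: map_f; rewrite mem_enum.
have [a [t [m'a e1]]] := maximal_comax m'M m'x0.
have [k Nk] := norm_int a.
have m'k : m' k%:~R by rewrite -Nk (bigD1 i1) //= g1; apply: idealMr.
have /dvdnP[c kE] := maximal_int m'M m'l m'k.
have mN : m (\prod_i g i a).
  rewrite Nk; have [->|->] : k = c%:Z * l%:Z \/ k = - (c%:Z * l%:Z) by lia.
    by rewrite intrM; apply: idealM.
  by rewrite intrN intrM; apply/idealN/idealM.
have [i mi] := maximal_prod mM mN.
apply: (maximal_not1 mM); rewrite -(rmorph1 (g i)) e1 rmorphD rmorphM.
by apply: idealD => //; apply: idealM.
Qed.

Variables (f : nat) (alpha : R).
Hypothesis alpha_mem : forall m, maximal_ideal m -> m l%:R -> m alpha.
Hypothesis alpha_rad : forall m x, maximal_ideal m -> m l%:R ->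
  (forall i, m (g i x)) -> exists t, x = t * alpha.

(** If some maximal ideal over [l] has norm [l ^ f], so have all of them, being
    conjugate; there are at most as many as automorphisms. *)
Lemma prod_maximal_norm_principal :
  principal_ideal (\big[@ideal_mul R/@unit_ideal R]_(m \in
    [set m : ideal R | maximal_ideal m /\ has_ideal_norm m (l ^ f)]) m).
Proof.
set S := [set m | _].
have S_l m : S m -> m l%:R.
  move=> [mM /norm_mem]; rewrite natrX; elim: (f) => [|n IHn].
    by rewrite expr0 => /(maximal_not1 mM).
  by rewrite exprS => /(maximal_prime mM)[].
have [->|[m Sm]] : S = set0 \/ S !=set0.
    by have [|] := pselect (S !=set0); [right | left; apply/nonemptyPn].
  exists 1; rewrite fsbig_set0; apply/seteqP; split=> // x _.
  by exists x => //; rewrite mul1r.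
have [mM mN] := Sm; have ml := S_l m Sm.
pose s := undup [seq ideal_preim (g i) m | i <- enum G].
have preim_l i : ideal_preim (g i) m l%:R by rewrite /= rmorph_nat.
have sP m' : m' \in s <-> S m'.
  rewrite mem_undup; split=> [/mapP[i _ ->]|Sm'].
    by split; [apply: maximal_preim | apply: norm_preim].
  have [i ->] := maximal_conjugate mM ml (proj1 Sm') (S_l m' Sm').
  by apply: map_f; rewrite mem_enum.
have -> : S = [set` s] by apply/seteqP; split=> m' /sP.
rewrite -fsbig_seq ?undup_uniq //.
exists alpha; apply/seteqP; split=> [x sx|_ [t _ <-]].
  have [|t ->] := @alpha_rad m x mM ml; last by exists t => //; rewrite mulrC.
  move=> i; have := @ideal_prod_sub R s (ideal_preim (g i) m) _ x sx.
  by apply; rewrite mem_undup; apply: map_f; rewrite mem_enum.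
apply: ideal_prod_inter; first exact: undup_uniq.
move=> J /sP[JM JN]; split=> //; rewrite mulrC; apply: idealM.
by apply: alpha_mem => //; apply: S_l.
Qed.
End ConjugateIdeals.

(** * Quadratic extensions and algebraic integers *)

Section Quadratic.
Variables (F : fieldType) (L : fieldExtType F) (E : {subfield L}) (x : L).
Hypothesis x2E : x ^+ 2 \in E.

Let P : {poly L} := 'X^2 - (x ^+ 2)%:P.
Let PE : P \is a polyOver E.
Proof. by rewrite rpredB ?polyOverC // rpredX // polyOverX. Qed.

(** Reduction of a polynomial in [x] modulo [X^2 - x^2]. *)
Lemma quadratic_decomp z :
  z \in <<E; x>>%VS -> exists a b, [/\ a \in E, b \in E & z = a + b * x].
Proof.
move=> /Fadjoin_polyP[p pE ->].
have rE : p %% P \is a polyOver E by rewrite modp_polyOver.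
exists (p %% P)`_0, (p %% P)`_1; split; rewrite ?(polyOverP rE) //.
have Px : P.[x] = 0 by rewrite !hornerE subrr.
rewrite {1}(divp_eq p P) hornerD hornerM Px mulr0 add0r.
have szP : size P = 3%N by rewrite size_XnsubC.
have P0 : P != 0 by rewrite -size_poly_eq0 szP.
rewrite (@horner_coef_wide _ 2); last by rewrite -ltnS -szP ltn_modpN0.
by rewrite !big_ord_recl big_ord0 /= expr0 mulr1 expr1 addr0.
Qed.

Hypotheses (xE : x \notin E) (full : <<E; x>>%VS = fullv).

(** The minimal polynomial of [x] over [E] is [X^2 - x^2], of which [- x] is
    another root. *)
Lemma quadratic_aut : (2 : L) != 0 -> exists s : {rmorphism L -> L},
  [/\ forall z, z \in E -> s z = z, s x = - x,
      forall z, s z = z -> z \in E & forall z, s (s z) = z].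
Proof.
move=> nz2.
have root_min : root (map_poly \1%VF (minPoly E x)) (- x).
  rewrite lfun1_poly.
  have min_dvd : minPoly E x %| P.
    by rewrite minPoly_dvdp // rootE !hornerE subrr.
  have szP : size P = 3%N by rewrite size_XnsubC.
  have P0 : P != 0 by rewrite -size_poly_eq0 szP.
  have : minPoly E x %= P.
    rewrite -(dvdp_size_eqp min_dvd) szP eqn_leq -{1}szP dvdp_leq //= size_minPoly.
    have := adjoin_deg_eq1 E x; rewrite (negPf xE) /adjoin_degree; lia.
  by move/eqp_root->; rewrite rootE !hornerE sqrrN subrr.
pose f := kHomExtend E \1 x (- x).
have fid z : z \in E -> f z = z.
  by move=> Ez; rewrite /f kHomExtend_id // ?lfunE //; apply: kHom1.
have fx : f x = - x by apply: kHomExtend_val (kHom1 1 E) root_min.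
have fhom : kHom 1 {:L} f.
  by rewrite -full; apply: (kHomExtendP (sub1v _) (kHom1 1 E) root_min).
have fM : monoid_morphism f by apply/kHom_monoid_morphism.
have fB : zmod_morphism f by move=> u v; apply: raddfB.
pose fz := GRing.isZmodMorphism.Build L L f fB.
pose fm := GRing.isMonoidMorphism.Build L L f fM.
pose s : {rmorphism L -> L} := HB.pack (f : L -> L) fz fm.
have sid z : z \in E -> s z = z by apply: fid.
have sx : s x = - x by apply: fx.
exists s; split=> // z; have zE : z \in <<E; x>>%VS by rewrite full memvf.
  all: have [a [b [aE bE ->]]] := quadratic_decomp zE.
  rewrite rmorphD rmorphM sx !sid // => /addrI /eqP.
  rewrite mulrN -subr_eq0 -opprD oppr_eq0 -mulr2n -mulr_natr mulf_eq0 (negPf nz2) orbF.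
  by move=> /eqP ->; rewrite addr0.
by rewrite !(rmorphD, rmorphM) sx rmorphN sx !sid // opprK.
Qed.
End Quadratic.

Section Integers.
Variable K : fieldExtType rat.
Local Notation O := (@alg_integer K).

Lemma natrK_eq0 n : (n%:R == 0 :> K) = (n == 0)%N.
Proof.
by rewrite -(rmorph_nat (in_alg K)) fmorph_eq0 pnatr_eq0.
Qed.

Lemma alg_integer_int (k : int) : k%:~R \in O.
Proof. by rewrite rpred_int. Qed.

Lemma alg_integer_nat (n : nat) : n%:R \in O.
Proof. by rewrite rpred_nat. Qed.

Lemma alg_integer_rmorph (s : {rmorphism K -> K}) z : z \in O -> s z \in O.
Proof.
move=> /asboolP[p p_mon pz]; apply/asboolP; exists p => //.
have -> : map_poly intr p = map_poly s (map_poly (intr : int -> K) p).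
  by rewrite -map_poly_comp; apply: eq_map_poly => k; rewrite /= rmorph_int.
by rewrite rmorph_root.
Qed.

Lemma alg_integer_sqr z : z ^+ 2 \in O -> z \in O.
Proof.
move=> /asboolP z2; apply/asboolP.
apply: (@integral_root_monic _ _ (intr : {rmorphism int -> K}) z ('X^2 - (z ^+ 2)%:P)).
- exact: monicXnsubC.
- by rewrite rootE !hornerE subrr.
apply/integral_poly => i; rewrite coefB coefXn coefC.
by apply: integral_sub; case: eqP => _ //; (exact: integral1 || exact: integral0).
Qed.

(** Transport to the algebraic numbers, where a rational algebraic integer is
    known to be an integer. *)
Lemma alg_integer_rat (a : rat) : a%:A \in O -> exists k : int, a%:A = k%:~R :> K.
Proof.
move=> /asboolP[p p_mon pa].
have pa' : root (map_poly (intr : int -> rat) p) a.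
  move: pa; have -> : map_poly (intr : int -> K) p =
      map_poly (in_alg K) (map_poly (intr : int -> rat) p).
    rewrite -map_poly_comp; apply: eq_map_poly => k.
    exact/esym/(rmorph_int (in_alg K)).
  by rewrite fmorph_root.
have : (ratr a : algC) \in Num.int.
  apply: Cint_rat_Aint; first exact: Crat_rat.
  apply: (@root_monic_Aint (map_poly (intr : int -> algC) p)).
  - have -> : map_poly (intr : int -> algC) p = map_poly ratr (map_poly (intr : int -> rat) p).
      by rewrite -map_poly_comp; apply: eq_map_poly => k; rewrite /= rmorph_int.
    by rewrite fmorph_root.
  - by rewrite monic_map.
  by apply/polyOverP => i; rewrite coef_map /= rpred_int.
move=> /intrP[k ak]; exists k.
have -> : a = k%:~R.
  by apply: (fmorph_inj (ratr : {rmorphism rat -> algC})); rewrite rmorph_int -ak.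
by rewrite -(rmorph_int (in_alg K)).
Qed.

(** A Bezout relation between [n] and [l]. *)
Lemma alg_integer_divn (l n : nat) z :
  (0 < l)%N -> coprime n l -> z \in O -> n%:R * z / l%:R \in O -> z / l%:R \in O.
Proof.
move=> l0 co zO nzO.
have l0K : l%:R != 0 :> K by rewrite natrK_eq0 -lt0n.
have /coprimezP[[u v] /= uv] : coprimez n l by [].
have -> : z / l%:R = u%:~R * (n%:R * z / l%:R) + v%:~R * z.
  have uvK : u%:~R * n%:R + v%:~R * l%:R = 1 :> K by rewrite !pmulrn -!intrM -intrD uv.
  transitivity ((u%:~R * n%:R + v%:~R * l%:R) * (z / l%:R)).
    by rewrite uvK mul1r.
  by rewrite mulrDl -!mulrA [l%:R * _]mulrC divfK.
by rewrite rpredD // rpredM // alg_integer_int.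
Qed.
End Integers.

(** * Divisibility by a prime through traces *)

(** It is a root of [X^2 - X - (n - 1) / 4]. *)
Lemma half_integer (K : fieldExtType rat) (n : nat) (d : K) :
  d ^+ 2 = n%:R -> (n %% 4 = 1)%N -> (1 + d) / 2 \in @alg_integer K.
Proof.
move=> d2 n1; apply/asboolP; pose m := (n %/ 4)%N.
have nE : n%:R = 4 * m%:R + 1 :> K by rewrite -natrM -(natrD _ _ 1%N); congr (_%:R); lia.
apply: (@integral_root_monic _ _ (intr : {rmorphism int -> K}) _ ('X^2 - ('X + m%:R%:P))).
- by rewrite monicE lead_coefDl -?monicE ?monicXn // size_polyN size_polyXn size_XaddC.
- rewrite rootE !hornerE; apply/eqP.
  have n2 : 2 != 0 :> K by rewrite natrK_eq0.
  rewrite (_ : m%:R = (d ^+ 2 - 1) / 4); last by rewrite d2 nE addrK mulrC mulKf // natrK_eq0.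
  by field; rewrite !natrK_eq0.
apply/(integral_poly (intr : {rmorphism int -> K})) => i; rewrite coefB coefXn coefD coefX coefC.
apply: integral_sub; first by case: eqP => _; [exact: integral1 | exact: integral0].
apply: integral_add; first by case: eqP => _; [exact: integral1 | exact: integral0].
by case: eqP => _; [exact: integral_nat | exact: integral0].
Qed.

Section TraceDescent.
Variables (K : fieldExtType rat) (s : {rmorphism K -> K}) (l n : nat) (d z : K).
Local Notation O := (@alg_integer K).
Hypotheses (l_gt0 : (0 < l)%N) (d2 : d ^+ 2 = n%:R) (sd : s d = - d) (zO : z \in O).

Let dO : d \in O.
Proof. by apply: alg_integer_sqr; rewrite d2 alg_integer_nat. Qed.

(** [2 n z = n (z + s z) + d ((z - s z) d)], as [d^2 = n]. *)
Lemma trace_descent : coprime (2 * n) l ->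
  (z + s z) / l%:R \in O -> (z - s z) * d / l%:R \in O -> z / l%:R \in O.
Proof.
move=> co AO BO; apply: (alg_integer_divn l_gt0 co zO).
have -> : (2 * n)%:R * z / l%:R = n%:R * ((z + s z) / l%:R) + d * ((z - s z) * d / l%:R).
  by rewrite natrM -d2; ring.
by rewrite rpredD // rpredM // alg_integer_nat.
Qed.

(** The factor 2 of the preceding identity is not invertible at [l = 2]. The
    trace of [z * h] avoids it, as [s h = 1 - h]:
    [d z = (h - 1) (z + s z) + (z h + s (z h))]. *)
Lemma half_trace_descent (h := (1 + d) / 2) : coprime n l -> (n %% 4 = 1)%N ->
  (z + s z) / l%:R \in O -> (z * h + s (z * h)) / l%:R \in O -> z / l%:R \in O.
Proof.
move=> co n1 AO BO; apply: (alg_integer_divn l_gt0 co zO).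
have n2 : 2 != 0 :> K by rewrite natrK_eq0.
have l0 : l%:R != 0 :> K by rewrite natrK_eq0 -lt0n.
have -> : n%:R * z / l%:R = d * ((h - 1) * ((z + s z) / l%:R) + (z * h + s (z * h)) / l%:R).
  by rewrite -d2 rmorphM fmorph_div rmorphD rmorph1 sd rmorph_nat /h; field; rewrite n2 l0.
by rewrite rpredM // rpredD // rpredM // rpredB ?(half_integer d2 n1) // rpred1.
Qed.
End TraceDescent.

Section IntegerMap.
Variables (K : fieldExtType rat) (s : {rmorphism K -> K}).

Definition integer_map (z : ring_of_integers K) : ring_of_integers K :=
  RingOfIntegers (alg_integer_rmorph s (valP z)).

Fact integer_map_zmod_morphism : zmod_morphism integer_map.
Proof. by move=> u v; apply: val_inj; rewrite /= !rmorphB. Qed.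
Fact integer_map_monoid_morphism : monoid_morphism integer_map.
Proof. by split=> [|u v]; apply: val_inj; rewrite /= ?rmorph1 ?rmorphM. Qed.
HB.instance Definition _ := GRing.isZmodMorphism.Build _ _ integer_map
  integer_map_zmod_morphism.
HB.instance Definition _ := GRing.isMonoidMorphism.Build _ _ integer_map
  integer_map_monoid_morphism.
End IntegerMap.

(** * The four automorphisms of a biquadratic field *)

Lemma rat_sqr_nonsquare (l n : nat) (a : rat) :
  prime l -> (l %| n)%N -> ~~ (l * l %| n)%N -> a ^+ 2 <> n%:R.
Proof.
move=> l_pr l_n l2_n a2.
have := coprime_num_den a; have := denq_gt0 a; have := esym (divq_num_den a).
move: (numq a) (denq a) => u v aE v0 co; rewrite {}aE in a2.
have v0Q : v%:~R != 0 :> rat by rewrite intr_eq0 gt_eqF.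
have uv : (absz u * absz u = n * (absz v * absz v))%N.
  have : u%:~R ^+ 2 = n%:R * v%:~R ^+ 2 :> rat.
    by rewrite -a2 expr_div_n divfK // expf_neq0.
  rewrite pmulrn !expr2 -!intrM => /intr_inj /(congr1 absz).
  by rewrite !abszM.
have v1 : absz v = 1%N.
  apply/eqP; rewrite -dvdn1 -(eqP co) dvdn_gcd dvdnn andbT.
  have : (absz v %| absz u * absz u)%N by rewrite uv mulnA dvdn_mull.
  by rewrite Gauss_dvdr // coprime_sym.
by apply: (nonsquare_of_prime l_pr l_n l2_n (m := absz u)); rewrite uv v1 !muln1.
Qed.

Section Rational.
Variable K : fieldExtType rat.

Lemma sqr_nonsquare (l n : nat) (a : K) :
  prime l -> (l %| n)%N -> ~~ (l * l %| n)%N -> a \in 1%VS -> a ^+ 2 <> n%:R.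
Proof.
move=> l_pr l_n l2_n /vlineP[b ->].
rewrite -[b *: 1]/(in_alg K b) -rmorphXn -(rmorph_nat (in_alg K)).
by move/fmorph_inj; apply: rat_sqr_nonsquare l_pr l_n l2_n.
Qed.

Lemma memv_nat1 n : (n%:R : K) \in 1%VS.
Proof. by rewrite -(rmorph_nat (in_alg K)); apply: memvZ; apply: mem1v. Qed.

(** If [a = u + v * b] with [u], [v] rational, then squaring shows that [b],
    [a] or [a * b] is rational. *)
Lemma sqrt_not_in_adjoin (m n l1 l2 l3 : nat) (a b : K) :
  a ^+ 2 = m%:R -> b ^+ 2 = n%:R ->
  [/\ prime l1, (l1 %| m)%N & ~~ (l1 * l1 %| m)%N] ->
  [/\ prime l2, (l2 %| n)%N & ~~ (l2 * l2 %| n)%N] ->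
  [/\ prime l3, (l3 %| m * n)%N & ~~ (l3 * l3 %| m * n)%N] ->
  a \notin <<1%AS; b>>%VS.
Proof.
move=> a2 b2 [p1 d1 n1] [p2 d2 n2] [p3 d3 n3]; apply/negP => ab.
have b2E : b ^+ 2 \in 1%AS by rewrite b2 memv_nat1.
have [u [v [uQ vQ aE]]] := quadratic_decomp b2E ab.
have [u0|u0] := eqVneq u 0.
  apply: (@sqr_nonsquare l3 (m * n) (a * b)) => //; last by rewrite exprMn a2 b2 natrM.
  by rewrite aE u0 add0r -mulrA -expr2; apply: rpredM.
have [v0|v0] := eqVneq v 0.
  apply: (@sqr_nonsquare l1 m a) => //.
  by rewrite aE v0 mul0r addr0.
apply: (@sqr_nonsquare l2 n b) => //.
have n2K : 2 != 0 :> K by rewrite natrK_eq0.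
have -> : b = (m%:R - u ^+ 2 - v ^+ 2 * n%:R) / (2 * u * v).
  by rewrite -a2 -b2 aE; field; rewrite v0 u0 n2K.
by rewrite rpred_div // ?rpredB ?rpredM ?rpredX ?memv_nat1.
Qed.
End Rational.

Section Biquadratic.
Variables (K : fieldExtType rat) (x y : K) (m n : nat).
Hypotheses (x2 : x ^+ 2 = m%:R) (y2 : y ^+ 2 = n%:R).
Hypotheses (xy : x \notin <<1%AS; y>>%VS) (yx : y \notin <<1%AS; x>>%VS).
Hypothesis (full : <<1 & [:: x; y]>>%VS = fullv).

(** [sx] is the conjugation over [Q(y)] and [sy] the one over [Q(x)]; an element
    fixed by both is in [Q(y)], and then in [Q]. *)
Lemma biquadratic_auts : exists sx sy : {rmorphism K -> K},
  [/\ [/\ sx x = - x, sx y = y, sy x = x & sy y = - y],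
      forall z, sx (sx z) = z, forall z, sy (sy z) = z,
      forall z, sx (sy z) = sy (sx z) &
      forall z, sx z = z -> sy z = z -> z \in 1%VS].
Proof.
have n2 : 2 != 0 :> K by rewrite natrK_eq0.
have fullxy : <<<<1%AS; x>>; y>>%VS = fullv by rewrite -full adjoin_cons adjoin_seq1.
have fullyx : <<<<1%AS; y>>; x>>%VS = fullv by rewrite adjoinC.
have x2Q : x ^+ 2 \in 1%AS by rewrite x2 memv_nat1.
have y2Q : y ^+ 2 \in 1%AS by rewrite y2 memv_nat1.
have x2y : x ^+ 2 \in <<1%AS; y>>%AS by rewrite x2 subvP_adjoin ?memv_nat1.
have y2x : y ^+ 2 \in <<1%AS; x>>%AS by rewrite y2 subvP_adjoin ?memv_nat1.
have [sx [sxE sxx sx_fix sxK]] := quadratic_aut x2y xy fullyx n2.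
have [sy [syE syy sy_fix syK]] := quadratic_aut y2x yx fullxy n2.
have sxy : sx y = y by apply: sxE; apply: memv_adjoin.
have syx : sy x = x by apply: syE; apply: memv_adjoin.
have sxQ z : z \in 1%AS -> sx z = z by move=> zQ; apply: sxE; apply: subvP_adjoin.
have syQ z : z \in 1%AS -> sy z = z by move=> zQ; apply: syE; apply: subvP_adjoin.
exists sx, sy; split=> // z.
  have [||A [B [AE BE ->]]] := @quadratic_decomp _ K <<1%AS; y>>%AS x _ z.
  - exact: x2y.
  - by rewrite fullyx memvf.
  have [a [b [aQ bQ ->]]] := quadratic_decomp y2Q AE.
  have [c [d [cQ dQ ->]]] := quadratic_decomp y2Q BE.
  rewrite !(rmorphD, rmorphM, rmorphN, sxx, sxy, syx, syy).
  by rewrite !(sxQ, syQ) //.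
move=> /sx_fix zE.
have [a [b [aQ bQ ->]]] := quadratic_decomp y2Q zE.
rewrite rmorphD rmorphM syy !syQ // => /addrI /eqP.
rewrite mulrN -subr_eq0 -opprD oppr_eq0 -mulr2n -mulr_natr mulf_eq0 (negPf n2) orbF.
by move=> /eqP ->; rewrite addr0.
Qed.
End Biquadratic.

(** * Ambiguous numbers and Ostrowski ideals *)

Section Ambiguous.
Variable K : fieldExtType rat.
Local Notation O := (@alg_integer K).

(** Equivalently, [a ^ 2] and [d] generate the same fractional ideal, whose
    square root is thus principal and invariant under the automorphisms. *)
Definition ambiguous (d : nat) : Prop :=
  exists a : K, [/\ a != 0, a ^+ 2 / d%:R \in O & d%:R / a ^+ 2 \in O].

Lemma ambiguous_cancel d e :
  (0 < d)%N -> (0 < e)%N -> ambiguous d -> ambiguous (d * e) -> ambiguous e.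
Proof.
move=> d0 e0 [b [b0 bd db]] [a [a0 ade dea]]; exists (a / b).
have d0K : d%:R != 0 :> K by rewrite natrK_eq0 -lt0n.
have e0K : e%:R != 0 :> K by rewrite natrK_eq0 -lt0n.
split; first by rewrite mulf_neq0 ?invr_eq0.
  have -> : (a / b) ^+ 2 / e%:R = (a ^+ 2 / (d * e)%:R) * (d%:R / b ^+ 2).
    by rewrite natrM; field; rewrite b0 e0K d0K.
  by rewrite rpredM.
have -> : e%:R / (a / b) ^+ 2 = ((d * e)%:R / a ^+ 2) * (b ^+ 2 / d%:R).
  by rewrite natrM; field; rewrite b0 a0 d0K.
by rewrite rpredM.
Qed.

Lemma ambiguous_sqrt d (a : K) : (0 < d)%N -> a ^+ 2 = d%:R -> ambiguous d.
Proof.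
move=> d0 a2; have d0K : d%:R != 0 :> K by rewrite natrK_eq0 -lt0n.
by exists a; rewrite a2 divff ?rpred1 //; split=> //; rewrite -sqrf_eq0 a2.
Qed.

(** [(d * a + b * sqrt N) ^ 2 = d * eta], where [eta] is a unit: its norm is
    [(d * a ^ 2 - e * b ^ 2) ^ 2 = 1]. *)
Lemma ambiguous_split N d (w : K) :
  (0 < N)%N -> w ^+ 2 = N%:R -> split_solution N d -> ambiguous d.
Proof.
move=> N0 w2 [e [a [b [de dab]]]].
have d0 : (0 < d)%N by move: N0; rewrite -de muln_gt0 => /andP[].
have d0K : d%:R != 0 :> K by rewrite natrK_eq0 -lt0n.
have wO : w \in O by apply: alg_integer_sqr; rewrite w2 alg_integer_nat.
have w2' : w ^+ 2 = d%:R * e%:R by rewrite w2 -de natrM.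
have dabK : d%:R * (a%:R * a%:R) = e%:R * (b%:R * b%:R) + 1 :> K.
  by rewrite -!natrM dab natrD.
pose s : K := d%:R * a%:R ^+ 2 + e%:R * b%:R ^+ 2; pose t : K := (2 * a * b)%:R.
have eta1 : (s + t * w) * (s - t * w) = 1.
  have -> : 1 = (d%:R * (a%:R * a%:R) - e%:R * (b%:R * b%:R)) ^+ 2 :> K.
    by rewrite dabK addrC addKr expr1n.
  have -> : (s + t * w) * (s - t * w) = s ^+ 2 - t ^+ 2 * w ^+ 2 by ring.
  by rewrite w2' /s /t !natrM; ring.
have alphaE : (d%:R * a%:R + b%:R * w) ^+ 2 = d%:R * (s + t * w).
  have -> : (d%:R * a%:R + b%:R * w) ^+ 2 =
    d%:R ^+ 2 * a%:R ^+ 2 + 2 * d%:R * a%:R * b%:R * w + b%:R ^+ 2 * w ^+ 2 by ring.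
  by rewrite w2' /s /t !natrM; ring.
have sO : s \in O by rewrite rpredD // rpredM ?rpredX ?alg_integer_nat.
have tO : t * w \in O by rewrite rpredM ?alg_integer_nat.
have eta0 : s + t * w != 0.
  by apply: contra_eq_neq eta1 => ->; rewrite mul0r eq_sym oner_eq0.
exists (d%:R * a%:R + b%:R * w); rewrite -sqrf_eq0 alphaE; split.
- by rewrite mulf_neq0.
- by rewrite mulrC mulKf // rpredD.
have -> : d%:R / (d%:R * (s + t * w)) = s - t * w.
  by rewrite invfM mulVKf // -[RHS]mul1r -(mulVf eta0) -mulrA eta1 mulr1.
by rewrite rpredB.
Qed.
End Ambiguous.

Section BiquadraticPolya.
Variables (K : fieldExtType rat) (sx sy : {rmorphism K -> K}).
Local Notation O := (@alg_integer K).
Hypotheses (sxK : forall z, sx (sx z) = z) (syK : forall z, sy (sy z) = z).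
Hypothesis sxyC : forall z, sx (sy z) = sy (sx z).
Hypothesis sxy_fix : forall z, sx z = z -> sy z = z -> z \in 1%VS.

Lemma fixed_integer z : z \in O -> sx z = z -> sy z = z -> exists k : int, z = k%:~R.
Proof.
move=> zO zx zy; have /vlineP[a za] := sxy_fix zx zy.
by rewrite za in zO *; exact: alg_integer_rat zO.
Qed.

Definition biquad_aut (b : bool * bool) : {rmorphism K -> K} :=
  GRing.RMorphism.clone K K
    ((if b.1 then sx else (idfun : {rmorphism K -> K})) \o
     (if b.2 then sy else (idfun : {rmorphism K -> K}))) _.

Lemma biquad_autE b z :
  biquad_aut b z = (if b.1 then sx : K -> K else id) ((if b.2 then sy : K -> K else id) z).
Proof. by case: b => [[] []]. Qed.

Lemma sx_biquad b z : sx (biquad_aut b z) = biquad_aut (~~ b.1, b.2) z.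
Proof. by rewrite !biquad_autE; case: b => [[] []] /=; rewrite ?sxK. Qed.

Lemma sy_biquad b z : sy (biquad_aut b z) = biquad_aut (b.1, ~~ b.2) z.
Proof. by rewrite !biquad_autE; case: b => [[] []] /=; rewrite -?sxyC ?syK. Qed.

Lemma biquad_sx b z : biquad_aut b (sx z) = biquad_aut (~~ b.1, b.2) z.
Proof. by rewrite !biquad_autE; case: b => [[] []] /=; rewrite -?sxyC ?sxK. Qed.

Lemma biquad_sy b z : biquad_aut b (sy z) = biquad_aut (b.1, ~~ b.2) z.
Proof. by rewrite !biquad_autE; case: b => [[] []] /=; rewrite ?syK. Qed.

Definition integer_aut (b : bool * bool) : {rmorphism ring_of_integers K -> ring_of_integers K} :=
  integer_map (biquad_aut b).

Lemma val_integer_aut b z : val (integer_aut b z) = biquad_aut b (val z).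
Proof. by []. Qed.

Lemma integer_aut_bij b : bijective (integer_aut b).
Proof.
exists (integer_aut b) => z; apply: val_inj; rewrite !val_integer_aut !biquad_autE;
 by case: b => [[] []] /=; rewrite ?sxyC ?syK -?sxyC ?sxK.
Qed.

(** The norm is invariant under both generators, hence rational. *)
Lemma integer_aut_norm z : exists k : int, \prod_b integer_aut b z = k%:~R.
Proof.
pose N := \prod_b biquad_aut b (val z).
have NE : val (\prod_b integer_aut b z) = N by rewrite rmorph_prod.
have [k Nk] : exists k : int, N = k%:~R.
  apply: fixed_integer; first by rewrite -NE; apply: valP.
    rewrite rmorph_prod (reindex_inj (h := fun b => (~~ b.1, b.2))).
      by apply: eq_bigr => b _; rewrite sx_biquad; case: b => [[] []].
    by move=> [b1 b2] [c1 c2] /= [/negb_inj -> ->].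
  rewrite rmorph_prod (reindex_inj (h := fun b => (b.1, ~~ b.2))).
    by apply: eq_bigr => b _; rewrite sy_biquad; case: b => [[] []].
  by move=> [b1 b2] [c1 c2] /= [-> /negb_inj ->].
by exists k; apply: val_inj; rewrite NE Nk rmorph_int.
Qed.

Variable l : nat.
Hypothesis l_pr : prime l.

(** The intersection of the conjugates of [m], read in [K]. *)
Definition radical_over (m : ideal (ring_of_integers K)) (z : K) : Prop :=
  exists2 w : ring_of_integers K, val w = z & forall b, m (integer_aut b w).

(** All that the divisibility arguments use about the intersection of the
    conjugates of a maximal ideal over [l]. *)
Definition radical_like (T : K -> Prop) : Prop :=
  [/\ forall z, T z -> z \in O,
      forall z w, T z -> T w -> T (z + w),
      forall z w, w \in O -> T z -> T (w * z),
      (forall z, T z -> T (sx z)) /\ (forall z, T z -> T (sy z)) &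
      forall z, T z -> sx z = z -> sy z = z -> z / l%:R \in O].

Lemma radical_overP m : maximal_ideal m -> m l%:R -> radical_like (radical_over m).
Proof.
move=> mM ml; split.
- by move=> _ [w <- _]; apply: valP.
- move=> _ _ [u <- mu] [v <- mv]; exists (u + v); first by rewrite rmorphD.
  by move=> b; rewrite rmorphD; apply: idealD.
- move=> _ w wO [u <- mu]; exists (RingOfIntegers wO * u); first by rewrite rmorphM.
  by move=> b; rewrite rmorphM; apply: idealM.
- split=> _ [w <- mw].
    exists (integer_map sx w) => // b; have := mw (~~ b.1, b.2).
    by congr (ideal_set m); apply: val_inj; apply/esym/(biquad_sx b (val w)).
  exists (integer_map sy w) => // b; have := mw (b.1, ~~ b.2).
  by congr (ideal_set m); apply: val_inj; apply/esym/(biquad_sy b (val w)).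
move=> _ [w <- mw] wx wy; have [k wk] := fixed_integer (valP w) wx wy.
have : m k%:~R.
  have := mw (false, false); congr (ideal_set m).
  by apply: val_inj; rewrite val_integer_aut biquad_autE wk rmorph_int.
move=> /(maximal_int l_pr mM ml) l_k; rewrite wk.
have [c ->] : exists c : int, k = c * l%:Z.
  by move: l_k => /dvdnP[c kE]; case: (ltrP k 0) => k0; [exists (- c%:Z) | exists c%:Z]; lia.
rewrite intrM mulfK ?alg_integer_int //.
by rewrite natrK_eq0 -lt0n prime_gt0.
Qed.

Lemma ostrowski_unramified (f : nat) :
  (forall T, radical_like T -> forall z, T z -> z / l%:R \in O) ->
  principal_ideal (ostrowski_ideal K l f).
Proof.
move=> unram.
have l0 : l%:R != 0 :> K by rewrite natrK_eq0 -lt0n prime_gt0.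
apply: (@prod_maximal_norm_principal _ _ integer_aut (false, false) integer_aut_bij
  _ integer_aut_norm l l_pr f l%:R) => //.
  by move=> z; apply: val_inj; rewrite val_integer_aut biquad_autE.
move=> m w mM ml mw.
have tO : val w / l%:R \in O by apply: (unram _ (radical_overP mM ml)); exists w.
by exists (RingOfIntegers tO); apply: val_inj; rewrite rmorphM rmorph_nat /= divfK.
Qed.

(** If [a ^ 2] is [l] times a unit and [z ^ 2 / l] is integral, then so is
    [(z / a) ^ 2], and therefore [z / a]. *)
Lemma ostrowski_ramified (f : nat) :
  ambiguous K l ->
  (forall T, radical_like T -> forall z, T z -> z ^+ 2 / l%:R \in O) ->
  principal_ideal (ostrowski_ideal K l f).
Proof.
move=> [a [a0 al la]] ram.
have l0 : l%:R != 0 :> K by rewrite natrK_eq0 -lt0n prime_gt0.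
have a2E : a ^+ 2 = (a ^+ 2 / l%:R) * l%:R by rewrite divfK.
have aO : a \in O.
  by apply: alg_integer_sqr; rewrite a2E rpredM // alg_integer_nat.
apply: (@prod_maximal_norm_principal _ _ integer_aut (false, false) integer_aut_bij
  _ integer_aut_norm l l_pr f (RingOfIntegers aO)) => //.
- by move=> z; apply: val_inj; rewrite val_integer_aut biquad_autE.
- move=> m mM ml; have : m (RingOfIntegers aO * RingOfIntegers aO).
    have -> : RingOfIntegers aO * RingOfIntegers aO = RingOfIntegers al * l%:R.
      by apply: val_inj; rewrite !rmorphM rmorph_nat /= -expr2 -a2E.
    exact: idealM.
  by move=> /(maximal_prime mM)[].
move=> m w mM ml mw.
have tO : val w / a \in O.
  apply: alg_integer_sqr.
  have -> : (val w / a) ^+ 2 = (val w ^+ 2 / l%:R) * (l%:R / a ^+ 2).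
    by field; rewrite a0 l0.
  by rewrite rpredM //; apply: (ram _ (radical_overP mM ml)); exists w.
by exists (RingOfIntegers tO); apply: val_inj; rewrite rmorphM /= divfK.
Qed.

Section RadicalLike.
Variable T : K -> Prop.
Hypothesis TP : radical_like T.

Lemma radical_likeN z : T z -> T (- z).
Proof. by case: TP => _ _ TM _ _ Tz; rewrite -mulN1r; apply: TM; rewrite ?rpredN ?rpred1. Qed.

(** [s] and [phi] generate the group; [phi] fixes a quadratic field, containing
    [d], in which [l] is unramified. So the traces to the rationals of [z]
    and of [z] times an integer of that field recover [z] up to a factor prime
    to [l]. *)
Lemma quadratic_unramified (s phi : {rmorphism K -> K}) (n : nat) (d : K) :
  (forall z, s (s z) = z) -> (forall z, s (phi z) = phi (s z)) ->
  (forall z, T z -> T (s z)) ->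
  (forall z, T z -> s z = z -> phi z = z -> z / l%:R \in O) ->
  d ^+ 2 = n%:R -> s d = - d -> phi d = d ->
  coprime n l -> odd l \/ (n %% 4 = 1)%N ->
  forall z, T z -> phi z = z -> z / l%:R \in O.
Proof.
move=> sK sphi Ts Tbase d2 sd phid co l_odd z Tz phiz.
have [TO TD TM _ _] := TP.
have l0 := prime_gt0 l_pr.
have dO : d \in O by apply: alg_integer_sqr; rewrite d2 alg_integer_nat.
have tr w : T w -> phi w = w -> (w + s w) / l%:R \in O.
  move=> Tw phiw; apply: Tbase; first by apply: TD => //; apply: Ts.
    by rewrite rmorphD sK addrC.
  by rewrite rmorphD -sphi phiw.
case: l_odd => [l_odd|n1].
  apply: (trace_descent l0 d2 (TO _ Tz) _ (tr _ Tz phiz)).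
    by rewrite coprimeMl co coprime2n l_odd.
  apply: Tbase.
  - by rewrite mulrC; apply: TM => //; apply: TD => //; apply/radical_likeN/Ts.
  - by rewrite rmorphM rmorphB sK sd mulrN -mulNr opprB.
  by rewrite rmorphM rmorphB -sphi phiz phid.
apply: (half_trace_descent l0 d2 sd (TO _ Tz) co n1 (tr _ Tz phiz)).
apply: tr.
  by rewrite mulrC; apply: TM => //; apply: half_integer d2 n1.
by rewrite rmorphM phiz fmorph_div rmorphD rmorph1 phid rmorph_nat.
Qed.

(** [z] is a root of [X ^ 2 - (z + phi z) * X + z * phi z], whose lower
    coefficients are multiples of [l] in the fixed field of [phi]. *)
Lemma ramified_sqr (phi : {rmorphism K -> K}) :
  (forall z, phi (phi z) = z) -> (forall z, T z -> T (phi z)) ->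
  (forall z, T z -> phi z = z -> z / l%:R \in O) ->
  forall z, T z -> z ^+ 2 / l%:R \in O.
Proof.
move=> phiK Tphi Tfix z Tz; have [TO TD TM _ _] := TP.
have -> : z ^+ 2 / l%:R = z * ((z + phi z) / l%:R) - (z * phi z) / l%:R by ring.
apply: rpredB.
  apply: rpredM; [exact: TO | apply: Tfix].
    by apply: TD => //; apply: Tphi.
  by rewrite rmorphD phiK addrC.
apply: Tfix; first by apply: TM; [apply: TO | apply: Tphi].
by rewrite rmorphM phiK mulrC.
Qed.

(** The traces of [z] and [z * d] to the fixed field of [phi] are multiples of
    [l] by hypothesis, and [2 * n * z] is a combination of them. *)
Lemma unramified_descent (phi : {rmorphism K -> K}) (n : nat) (d : K) :
  (forall z, phi (phi z) = z) -> (forall z, T z -> T (phi z)) ->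
  (forall z, T z -> phi z = z -> z / l%:R \in O) ->
  d ^+ 2 = n%:R -> phi d = - d -> coprime (2 * n) l ->
  forall z, T z -> z / l%:R \in O.
Proof.
move=> phiK Tphi Tfix d2 phid co z Tz; have [TO TD TM _ _] := TP.
have dO : d \in O by apply: alg_integer_sqr; rewrite d2 alg_integer_nat.
apply: (trace_descent (prime_gt0 l_pr) d2 (s := phi) (TO _ Tz) co); apply: Tfix.
- by apply: TD => //; apply: Tphi.
- by rewrite rmorphD phiK addrC.
- by rewrite mulrC; apply: TM => //; apply: TD => //; apply/radical_likeN/Tphi.
by rewrite rmorphM rmorphB phiK phid mulrN -mulNr opprB.
Qed.
End RadicalLike.
End BiquadraticPolya.

(** * Biquadratic fields all of whose ramified primes are ambiguous *)

Section PolyaCriterion.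
Variables (K : fieldExtType rat) (x y : K) (p t : nat).
Hypothesis pt_coprime : coprime p t.
Hypothesis pt_mod4 : (p * t %% 4 = 1)%N.
Hypotheses (x_sqrt : x ^+ 2 = (2 * p)%N%:R) (y_sqrt : y ^+ 2 = (2 * t)%N%:R).
Hypotheses (x_notin : x \notin <<1%AS; y>>%VS) (y_notin : y \notin <<1%AS; x>>%VS).
Hypothesis K_gen : <<1 & [:: x; y]>>%VS = fullv.
Hypothesis ramified_ambiguous :
  forall l, prime l -> (l %| 2 * p * t)%N -> ambiguous K l.

Lemma half_xy_sqrt : (x * y / 2) ^+ 2 = (p * t)%N%:R.
Proof.
have n2 : 2 != 0 :> K by rewrite natrK_eq0.
by rewrite !exprMn x_sqrt y_sqrt !natrM; field.
Qed.

(** With [m1 = 2p], [m2 = 2t], [m3 = pt] the radicands, a prime is unramified in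
    one of the quadratic subfields: [Q(sqrt m3)] for 2, [Q(y)] for the divisors
    of [p], [Q(x)] for those of [t], and any of them for the other primes. *)
Lemma biquadratic_polya : polya_field K.
Proof.
have [sx [sy [[sxx sxy syx syy] sxK syK sC fixQ]]] :=
  biquadratic_auts x_sqrt y_sqrt x_notin y_notin K_gen.
have sC' z : sy (sx z) = sx (sy z) by rewrite sC.
move=> l f l_pr _.
have fix_sx (T : K -> Prop) : radical_like sx sy l T -> coprime (2 * t) l ->
    forall z, T z -> sx z = z -> z / l%:R \in @alg_integer K.
  move=> TP co; have [_ _ _ [Tx Ty] Tb] := TP.
  apply: (quadratic_unramified l_pr TP syK sC' Ty _ y_sqrt syy sxy co).
    by move=> z Tz zy zx; apply: Tb.
  by left; move: co; rewrite coprimeMl coprime2n => /andP[].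
have fix_sy (T : K -> Prop) : radical_like sx sy l T -> coprime (2 * p) l ->
    forall z, T z -> sy z = z -> z / l%:R \in @alg_integer K.
  move=> TP co; have [_ _ _ [Tx Ty] Tb] := TP.
  apply: (quadratic_unramified l_pr TP sxK sC Tx _ x_sqrt sxx syx co) => //.
  by left; move: co; rewrite coprimeMl coprime2n => /andP[].
have [l_ram|l_unram] := boolP (l %| 2 * p * t)%N; last first.
  apply: (ostrowski_unramified sxK syK sC fixQ l_pr) => T TP.
  have [_ _ _ [Tx Ty] Tb] := TP.
  move: l_unram; rewrite -prime_coprime // coprime_sym !coprimeMl -andbA.
  move=> /and3P[l2 lp lt].
  apply: (unramified_descent l_pr TP sxK Tx _ x_sqrt sxx); last by rewrite !coprimeMl l2 lp.
  by apply: fix_sx => //; rewrite coprimeMl l2 lt.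
apply: (ostrowski_ramified sxK syK sC fixQ l_pr); first exact: ramified_ambiguous.
move=> T TP; have [_ _ _ [Tx Ty] Tb] := TP.
have odd_pt : odd (p * t) by move: pt_mod4; lia.
have [l2|l2] := eqVneq l 2.
  have coK z : (sx \o sy) ((sx \o sy) z) = z by rewrite /= -sC sxK syK.
  apply: (ramified_sqr TP coK); first by move=> z Tz; apply/Tx/Ty.
  have co : coprime (p * t) l by rewrite l2 coprimen2.
  apply: (quadratic_unramified l_pr TP sxK _ Tx _ half_xy_sqrt _ _ co).
  - by move=> z; rewrite /= sC'.
  - by move=> z Tz zx /= zxy; apply: Tb => //; rewrite -[RHS]zxy sC zx.
  - by rewrite fmorph_div rmorphM sxx sxy rmorph_nat mulNr mulNr.
  - by rewrite /= !(fmorph_div, rmorphM) syx syy rmorphN sxx sxy !rmorph_nat mulrNN.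
  by right.
have co2 : coprime 2 l by rewrite prime_coprime // dvdn_prime2 // eq_sym.
move: l_ram; rewrite -mulnA Euclid_dvdM // dvdn_prime2 // (negPf l2) /=.
rewrite Euclid_dvdM // => /orP[lp|lt].
  apply: (ramified_sqr TP sxK Tx); apply: fix_sx => //.
  rewrite coprimeMl co2 coprime_sym; apply: coprime_dvdl lp _; exact: pt_coprime.
apply: (ramified_sqr TP syK Ty); apply: fix_sy => //.
by rewrite coprimeMl co2; apply: coprime_dvdr lt _.
Qed.
End PolyaCriterion.

(** * The field of the theorem *)

Section RamifiedPrimes.
Variables (p q r s : nat) (K : fieldExtType rat) (x y : K).
Hypotheses (p_pr : prime p) (q_pr : prime q) (r_pr : prime r) (s_pr : prime s).
Hypothesis (pqrs_uniq : uniq [:: p; q; r; s]).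
Hypotheses (p_mod4 : p = 3 %[mod 4]) (q_mod4 : q = 3 %[mod 4]).
Hypotheses (r_mod4 : r = 3 %[mod 4]) (s_mod4 : s = 3 %[mod 4]).
Hypotheses (x_sqrt : x ^+ 2 = (2 * p)%N%:R) (y_sqrt : y ^+ 2 = (2 * q * r * s)%N%:R).
Hypotheses (leg2_rs : legendre 2 r = legendre 2 s) (leg2_sq : legendre 2 s <> legendre 2 q).
Hypotheses (leg_qr_rs : legendre q r = legendre r s).
Hypotheses (leg_rs_sq : legendre r s = legendre s q).
Hypotheses (leg_pr_s : legendre (p * r)%N s = -1) (leg_ps_r : legendre (p * s)%N r = -1).

Local Notation amb := (ambiguous K).

(** The splitting of [2p] and quotients give [2], [p] and [qrs]. Up to these,
    the splitting of [2qrs] is [r] or [s], and that of [pqrs] is [q]; the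
    remaining prime is a quotient of [qrs]. *)
Lemma ramified_primes_ambiguous : [/\ amb 2, amb p, amb q & amb r /\ amb s].
Proof.
have [p0 q0 r0 s0] : [/\ 0 < p, 0 < q, 0 < r & 0 < s]%N by split; apply: prime_gt0.
have div d e : (0 < d)%N -> (0 < e)%N -> amb d -> amb (d * e) -> amb e.
  exact: ambiguous_cancel.
have amb2p : amb (2 * p) by apply: ambiguous_sqrt x_sqrt; rewrite muln_gt0.
have amb2 : amb 2.
  have p2_gt0 : (0 < 2 * p)%N by rewrite muln_gt0.
  have [/(ambiguous_split p2_gt0 x_sqrt) //|] := split_2p p_pr p_mod4.
  move=> /(ambiguous_split p2_gt0 x_sqrt) ambp.
  by apply: (div p) => //; rewrite mulnC.
have ambp : amb p by apply: (div 2).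
have N_gt0 : (0 < 2 * q * r * s)%N by rewrite !muln_gt0 q0 r0 s0.
have amb_qrs : amb (q * r * s).
  apply: (div 2) => //; first by rewrite !muln_gt0 q0 r0 s0.
  by rewrite !mulnA; apply: ambiguous_sqrt y_sqrt.
have r_or_s : amb r \/ amb s.
  have [d dsol] := split_2qrs p_pr q_pr r_pr s_pr pqrs_uniq p_mod4 q_mod4 r_mod4 s_mod4
    leg2_rs leg2_sq leg_qr_rs leg_rs_sq leg_pr_s leg_ps_r.
  have := ambiguous_split N_gt0 y_sqrt dsol.
  move=> ambd [] dE; rewrite dE in ambd.
  - by left; apply: (div 2).
  - left; apply: (div (q * s)%N) => //; first by rewrite muln_gt0 q0.
    by rewrite mulnAC.
  - by right; apply: (div 2).
  right; apply: (div (q * r)%N) => //; first by rewrite muln_gt0 q0.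
have ambq : amb q.
  have [d dsol] := split_pqrs p_pr q_pr r_pr s_pr pqrs_uniq p_mod4 q_mod4 r_mod4 s_mod4
    leg2_rs leg2_sq leg_qr_rs leg_rs_sq leg_pr_s leg_ps_r.
  have w_sqrt : (x * y / 2) ^+ 2 = (p * q * r * s)%N%:R.
    have -> : (p * q * r * s = p * (q * r * s))%N by ring.
    by apply: half_xy_sqrt x_sqrt _; rewrite y_sqrt !mulnA.
  have := ambiguous_split _ w_sqrt dsol; rewrite !muln_gt0 p0 q0 r0 s0 => /(_ isT).
  move=> ambd [] dE; rewrite dE in ambd; first by apply: (div p).
  apply: (div (r * s)%N) => //; first by rewrite muln_gt0 r0.
  by rewrite mulnC mulnA.
have ambrs : amb (r * s).
  by apply: (div q) => //; rewrite ?muln_gt0 ?r0 // mulnA.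
split=> //; case: r_or_s => [ambr|ambs]; split=> //; first exact: (div r).
by apply: (div s) => //; rewrite mulnC.
Qed.
End RamifiedPrimes.

Theorem theorem6 (p q r s : nat) (K : fieldExtType rat) (x y : K)
  (p_pr : prime p) (q_pr : prime q) (r_pr : prime r) (s_pr : prime s)
  (pqrs_uniq : uniq [:: p; q; r; s])
  (p_mod4 : p = 3 %[mod 4]) (q_mod4 : q = 3 %[mod 4])
  (r_mod4 : r = 3 %[mod 4]) (s_mod4 : s = 3 %[mod 4])
  (x_sqrt : x ^+ 2 = (2 * p)%N%:R) (y_sqrt : y ^+ 2 = (2 * q * r * s)%N%:R)
  (K_gen : <<1 & [:: x; y]>>%VS = fullv)
  (leg2_rs : legendre 2 r = legendre 2 s) (leg2_sq : legendre 2 s <> legendre 2 q)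
  (leg_qr_rs : legendre q r = legendre r s)
  (leg_rs_sq : legendre r s = legendre s q)
  (leg_pr_s : legendre (p * r)%N s = -1) (leg_ps_r : legendre (p * s)%N r = -1) :
  polya_field K.
Proof.
have [p0 q0 r0 s0] : [/\ 0 < p, 0 < q, 0 < r & 0 < s]%N by split; apply: prime_gt0.
have [pq pr ps] : [/\ p != q, p != r & p != s].
  by move: pqrs_uniq; rewrite /= !inE !negb_or => /andP[/and3P[]].
have [qr qs] : q != r /\ q != s.
  by move: pqrs_uniq; rewrite /= !inE !negb_or => /and3P[_ /andP[]].
have p2 : p != 2 by apply/eqP=> p2; move: p_mod4; rewrite p2.
have q2 : q != 2 by apply/eqP=> q2; move: q_mod4; rewrite q2.
have co l a : prime l -> prime a -> l != a -> coprime l a.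
  by move=> lP aP; rewrite prime_coprime // dvdn_prime2.
have co_pt : coprime p (q * r * s) by rewrite !coprimeMr !co.
have y_sqrt' : y ^+ 2 = (2 * (q * r * s))%N%:R by rewrite y_sqrt !mulnA.
have xF : [/\ prime p, (p %| 2 * p)%N & ~~ (p * p %| 2 * p)%N].
  rewrite (mulnC 2%N); split=> //; first exact: dvdn_mulr.
  by apply: prime_coprime_not_sq_dvd => //; rewrite co.
have yF : [/\ prime q, (q %| 2 * (q * r * s))%N & ~~ (q * q %| 2 * (q * r * s))%N].
  have -> : (2 * (q * r * s) = q * (2 * r * s))%N by ring.
  split=> //; first exact: dvdn_mulr.
  by apply: prime_coprime_not_sq_dvd => //; rewrite !coprimeMr !co.
have xyF : [/\ prime p, (p %| 2 * p * (2 * (q * r * s)))%N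
             & ~~ (p * p %| 2 * p * (2 * (q * r * s)))%N].
  have -> : (2 * p * (2 * (q * r * s)) = p * (2 * 2 * (q * r * s)))%N by ring.
  split=> //; first exact: dvdn_mulr.
  by apply: prime_coprime_not_sq_dvd => //; rewrite !coprimeMr !co.
have x_notin := sqrt_not_in_adjoin x_sqrt y_sqrt' xF yF xyF.
have y_notin : y \notin <<1%AS; x>>%VS.
  rewrite (mulnC (2 * p)%N) in xyF.
  exact: sqrt_not_in_adjoin y_sqrt' x_sqrt yF xF xyF.
have [a2 ap aq [ar as_]] := ramified_primes_ambiguous p_pr q_pr r_pr s_pr pqrs_uniq
  p_mod4 q_mod4 r_mod4 s_mod4 x_sqrt y_sqrt leg2_rs leg2_sq leg_qr_rs leg_rs_sq
  leg_pr_s leg_ps_r.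
apply: (biquadratic_polya co_pt _ x_sqrt y_sqrt' x_notin y_notin K_gen).
  rewrite mulnA -modnMm -(modnMm p) -(modnMm q).
  by rewrite p_mod4 q_mod4 r_mod4 s_mod4.
move=> l l_pr; rewrite !Euclid_dvdM // !dvdn_prime2 //.
by do ![case/orP]; move=> /eqP ->.
Qed.
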